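(* Let $a,m\ge0$, $\ell\ge1$ and $0\le p\le\ell$ be integers, and let $\mathcal{C}^p_\ell(m,a)$ be the arrangement in $\mathbb{R}^\ell$ consisting of the hyperplanes $x_i+x_j=s$ and $x_i-x_j=s$ for $1\le i<j\le\ell$ and integers $-a\le s\le a$; $2x_i=s$ for $1\le i\le p$ and integers $1-m\le s\le m$; and $2x_i=s$ for $p<i\le\ell$ and integers $-m\le s\le m$. Then the cone $\mathbf{c}\mathcal{C}^p_\ell(m,a)$ is free with exponents $$\big(1,\ c+2\ell-p-1,\ c+1,\ c+3,\ c+5,\dots,\ c+2\ell-3\big),\qquad c=2m+2a\ell-2a.$$
   Context: For an affine arrangement $\mathcal{A}$ in $\mathbb{R}^\ell$, its cone $\mathbf{c}\mathcal{A}$ is the central arrangement in $\mathbb{R}^{\ell+1}$ (extra coordinate $z$) consisting of the hyperplanes $a_1x_1+\dots+a_\ell x_\ell=dz$ for each hyperplane $a_1x_1+\dots+a_\ell x_\ell=d$ of $\mathcal{A}$, together with $z=0$. A central arrangement $\mathcal{A}$ in $\mathbb{R}^n$ is free if $D(\mathcal{A})=\{\theta\in\mathrm{Der}(S):\theta(\alpha_H)\in\alpha_HS\text{ for all }H=\ker\alpha_H\in\mathcal{A}\}$ is a free module over $S=\mathbb{R}[x_1,\dots,x_n]$; the exponents are the degrees of a homogeneous basis. *)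

(* Defs.v *)
From mathcomp Require Import all_boot all_order all_algebra.
From mathcomp Require Import classical_sets reals.
From mathcomp Require Import mpoly.

Set Implicit Arguments.
Unset Strict Implicit.
Unset Printing Implicit Defensive.

Import Order.TTheory GRing.Theory Num.Theory.

Local Open Scope classical_set_scope.
Local Open Scope ring_scope.

(* Hyperplanes are given by defining equations: [v] stands for the linear
   hyperplane v . x = 0, and [(v, d)] for the affine hyperplane v . x = d.
   The types impose neither v != 0 nor finiteness of the arrangement; both
   hold for the arrangement [C_arrangement] below and for its cone. *)
Definition central_arrangement (R : realType) (n : nat) := set 'rV[R]_n.
Definition affine_arrangement (R : realType) (l : nat) := set ('rV[R]_l * R).

Definition linform (R : realType) (n : nat) (v : 'rV[R]_n) : {mpoly R[n]} :=
  \sum_(i < n) v ord0 i *: 'X_i.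

(* The additional coordinate z is the last one. *)
Definition cone (R : realType) (l : nat) (A : affine_arrangement R l) :
    central_arrangement R (l + 1) :=
  row_mx 0 1%:M |` [set row_mx h.1 (- h.2)%:M | h in A].

Section LogarithmicDerivations.
Variables (R : realType) (n : nat).
Implicit Types (A : central_arrangement R n).
Implicit Types (theta : {mpoly R[n]} -> {mpoly R[n]}).

Definition derivation theta : Prop :=
  linear theta /\ forall f g, theta (f * g) = theta f * g + f * theta g.

Definition D A : set ({mpoly R[n]} -> {mpoly R[n]}) :=
  [set theta | derivation theta /\
    forall v, A v -> exists q, theta (linform v) = linform v * q].

(* [b] is a basis of [D A] as a module over {mpoly R[n]}. *)
Definition D_basis A (k : nat) (b : 'I_k -> {mpoly R[n]} -> {mpoly R[n]}) :
    Prop :=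
  [/\ forall i, D A (b i),
      forall theta, D A theta -> exists s : 'I_k -> {mpoly R[n]},
        forall f, theta f = \sum_(i < k) s i * b i f
    & forall s : 'I_k -> {mpoly R[n]},
        (forall f, \sum_(i < k) s i * b i f = 0) -> forall i, s i = 0].

(* A finite basis is no restriction, as [D A] is finitely generated. *)
Definition free_arrangement A : Prop :=
  exists k (b : 'I_k -> {mpoly R[n]} -> {mpoly R[n]}), D_basis A b.

(* Polynomial degree: theta = \sum_i f_i d/dx_i has degree d when every
   f_i = theta x_i is homogeneous of degree d. *)
Definition homogeneous_derivation (d : nat) theta : Prop :=
  forall i : 'I_n, theta 'X_i \is d.-homog.

(* The order of the list [e] is irrelevant: a basis can be reindexed. *)
Definition has_exponents A (e : seq nat) : Prop :=
  exists b : 'I_(size e) -> {mpoly R[n]} -> {mpoly R[n]},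
    D_basis A b /\
    forall i : 'I_(size e), homogeneous_derivation (nth 0%N e i) (b i).

End LogarithmicDerivations.

(* Coordinates are numbered from 0, so that 1 <= i <= p becomes i < p. *)
Definition C_arrangement (R : realType) (l p m a : nat) :
    affine_arrangement R l :=
  let x (i : 'I_l) : 'rV[R]_l := delta_mx ord0 i in
  [set h |
    [\/ exists (i j : 'I_l) (s : int),
          [/\ (i < j)%N, - a%:Z <= s <= a%:Z & h = (x i + x j, s%:~R)],
        exists (i j : 'I_l) (s : int),
          [/\ (i < j)%N, - a%:Z <= s <= a%:Z & h = (x i - x j, s%:~R)],
        exists (i : 'I_l) (s : int),
          [/\ (i < p)%N, 1 - m%:Z <= s <= m%:Z & h = (2 *: x i, s%:~R)]
      | exists (i : 'I_l) (s : int),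
          [/\ (p <= i)%N, - m%:Z <= s <= m%:Z & h = (2 *: x i, s%:~R)]]].

Arguments C_arrangement : clear implicits.

(* Main.v *)
(* Besides the Euler derivation, the basis consists of discrete integrals.  At
   infinity (z = 0) they are the classical
     x_i |-> F_E(x_i),  F_E(t) = \int_0^t u^(2E) \prod_k (u^2 - x_k^2)^a du
   with E = m - a + j, continued analytically to E < 0.  For z != 0 put h = z/2,
   let psi_M(t) be the product of the t - s h for |s| <= M (with psi_(-1-M) =
   1/psi_M) and replace d/dt by F(t + h) - F(t - h).  The power t^(2M) becomes
   kap_M(t) = t psi_(M-1)(t), of which psi_M/(2M+1) is an antidifference, up to
   a factor 2h, and (t^2 - x^2)^a becomes the product of the t^2 - (x + q h)^2
   over the a shifts q = 1-a, 3-a, ..., a-1.  For odd a the integrand is moreover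
   averaged over t + h and t - h.

   If x_i = +-x_j + s z with |s| <= a, then F(x_i) - F(+-x_j) is a sum of values
   of the integrand between the two points, all of which are zero.  F(x_i)
   itself is a polynomial, and vanishes for 2 x_i = s z, |s| <= m, because in rank
   one the discrete integral up to t = x has a closed form, a multiple of
   psi_(E+a)(x).  The rational function F(t) is only used at points where it is
   regular, which are dense in each hyperplane.

   The derivation of degree c + 2l - p - 1 is F_E for E = m - a - 1 times linear
   factors that restore the hyperplanes 2 x_i = +-m z.

   By Saito's criterion it remains to see that the determinant is nonzero.  At
   z = 0 a linear relation at a point x yields a nonzero polynomial g of degree
   < l in T = t^2 such that the integral of t^(2E) g(t^2) \prod_k (t^2 - x_k^2)^a
   vanishes at all x_i; it is then divisible by \prod_k (t^2 - x_k^2)^(a+1), which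
   is impossible by degree. *)
Require Import Defs.
From mathcomp Require Import all_boot all_order all_algebra.
From mathcomp Require Import perm boolp classical_sets reals mpoly.
From mathcomp Require Import ring lra zify.

Set Implicit Arguments.
Unset Strict Implicit.
Unset Printing Implicit Defensive.

Import Order.TTheory GRing.Theory Num.Theory.
Local Open Scope ring_scope.

(** * Polynomials and linear forms *)

Lemma mpoly_alg_ind (R : nzRingType) (n : nat) (P : {mpoly R[n]} -> Prop) :
  (forall c, P c%:MP) -> (forall i, P 'X_i) ->
  (forall p q, P p -> P q -> P (p + q)) ->
  (forall p q, P p -> P q -> P (p * q)) -> forall p, P p.
Proof.
move=> PC PX PD PM p; rewrite (mpolyE p); apply: (big_ind P) => [||m _].
- by rewrite -mpolyC0.
- exact: PD.
rewrite -mul_mpolyC; apply: (PM) => //.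
rewrite mpolyXE_id; apply: (big_ind P) => [||i _]; [by rewrite -mpolyC1 | exact: PM |].
elim: (m i) => [|k IHk]; first by rewrite expr0 -mpolyC1.
by rewrite exprS; apply: (PM).
Qed.

Lemma mpoly_rmorph_eq (R S : nzRingType) (n : nat)
    (f g : {rmorphism {mpoly R[n]} -> S}) :
  (forall c, f c%:MP = g c%:MP) -> (forall i, f 'X_i = g 'X_i) -> f =1 g.
Proof.
move=> fgC fgX; apply: mpoly_alg_ind => // p q fgp fgq.
  by rewrite !rmorphD fgp fgq.
by rewrite !rmorphM fgp fgq.
Qed.

Lemma mmapXU (n : nat) (R : nzRingType) (S : comNzRingType)
    (f : {rmorphism R -> S}) (h : 'I_n -> S) (i : 'I_n) :
  mmap f h 'X_i = h i.
Proof. by rewrite [LHS]mmapX mmap1U. Qed.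

Lemma poly_eq0_all_roots (R : numFieldType) (p : {poly R}) :
  (forall x, p.[x] = 0) -> p = 0.
Proof.
move=> p0; apply/eqP; apply: contraT => pN0.
have := @max_poly_roots R p [seq i%:R | i <- iota 0 (size p)] pN0.
rewrite size_map size_iota ltnn; apply.
  by apply/allP => x _; rewrite /root p0.
by rewrite map_inj_uniq ?iota_uniq // => i j /eqP; rewrite eqr_nat => /eqP.
Qed.

(** Induction on the number of variables: [uni] reads a polynomial as univariate in the last
    variable, with inverse [back], and each coefficient vanishes at all points. *)
Lemma mpoly_eq0_eval (R : numFieldType) (n : nat) (p : {mpoly R[n]}) :
  (forall v, p.@[v] = 0) -> p = 0.
Proof.
elim: n p => [|n IHn] p p0.
  have pC : p.@[fun=> 0]%:MP = p.
    change ((@mpolyC 0 R \o meval (fun=> 0)) p = idfun p).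
    by apply: mpoly_rmorph_eq => [c|[]//] /=; rewrite mevalC.
  by rewrite -pC p0 mpolyC0.
pose X (i : 'I_n.+1) : {poly {mpoly R[n]}} :=
  if unlift ord_max i is Some j then ('X_j)%:P else 'X.
pose uni : {mpoly R[n.+1]} -> {poly {mpoly R[n]}} :=
  mmap (polyC \o @mpolyC n R) X.
pose inj : {mpoly R[n]} -> {mpoly R[n.+1]} :=
  mmap (@mpolyC n.+1 R) (fun j => 'X_(lift ord_max j)).
pose back : {poly {mpoly R[n]}} -> {mpoly R[n.+1]} :=
  horner_eval 'X_ord_max \o map_poly inj.
have uniK : back (uni p) = p.
  change ((back \o uni) p = idfun p).
  apply: mpoly_rmorph_eq => [c|i] /=.
    by rewrite /back /uni /= mmapC /= map_polyC /horner_eval /= hornerC; exact: mmapC.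
  rewrite /back /uni /= mmapXU /X; case: unliftP => [j ->|->] /=.
    by rewrite map_polyC /horner_eval hornerC; exact: mmapXU.
  by rewrite map_polyX /horner_eval hornerX.
suff -> : p = back 0 by rewrite /back /= map_poly0 /horner_eval horner0.
rewrite -uniK; congr back; apply/polyP => k; rewrite coef0.
apply: IHn => w.
suff : map_poly (meval w) (uni p) = 0.
  by move=> /polyP /(_ k); rewrite coef_map coef0.
apply: poly_eq0_all_roots => t.
rewrite -(p0 (fun i => if unlift ord_max i is Some j then w j else t)).
change ((horner_eval t \o (map_poly (meval w) \o uni)) p = meval
  (fun i => if unlift ord_max i is Some j then w j else t) p).
apply: mpoly_rmorph_eq => [c|i] /=.
  rewrite /uni mmapC /= map_polyC /horner_eval hornerC mevalC. exact: mevalC.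
rewrite /uni mmapXU mevalXU /X; case: unliftP => [j _|_] /=.
  by rewrite map_polyC /horner_eval hornerC; exact: mevalXU.
by rewrite map_polyX /horner_eval hornerX.
Qed.

Lemma meval_linform (R : realType) (n : nat) (v : 'rV[R]_n) (w : 'I_n -> R) :
  (linform v).@[w] = \sum_(i < n) v ord0 i * w i.
Proof.
rewrite /linform raddf_sum; apply: eq_bigr => i _ /=.
by rewrite mevalZ mevalXU.
Qed.

Definition linform_divides (R : realType) (n : nat) (v : 'rV[R]_n)
  (f : {mpoly R[n]}) := exists q, f = linform v * q.

(* The projection along a coordinate axis onto the hyperplane v . x = 0 is the
   identity modulo [linform v], and it maps {mpoly R[n]} to a domain. *)
Lemma linform_divides_generic (R : realType) (n : nat) (v : 'rV[R]_n)
    (f g : {mpoly R[n]}) (w0 : 'I_n -> R) :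
  v != 0 -> (linform v).@[w0] = 0 -> g.@[w0] != 0 ->
  (forall w, (linform v).@[w] = 0 -> g.@[w] != 0 -> f.@[w] = 0) ->
  linform_divides v f.
Proof.
move=> v0 vw0 gw0 fw.
have [i vi] : exists i, v ord0 i != 0.
  apply/existsP; apply: contraNT v0; rewrite negb_exists => /forallP v0.
  by apply/eqP/rowP => i; rewrite mxE; apply/eqP; move: (v0 i); rewrite negbK.
pose pr : {mpoly R[n]} -> {mpoly R[n]} := mmap (@mpolyC n R)
  (fun k => 'X_k - (if k == i then (v ord0 i)^-1 else 0) *: linform v).
have prP p : linform_divides v (p - pr p).
  elim/mpoly_alg_ind: p => [c|k|p q [p' Ep] [q' Eq]|p q [p' Ep] [q' Eq]].
  - by exists 0; rewrite /pr mmapC subrr mulr0.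
  - exists (if k == i then (v ord0 i)^-1 else 0)%:MP.
    by rewrite /pr mmapXU opprB addrC subrK mulrC mul_mpolyC.
  - exists (p' + q'); rewrite {1}/pr rmorphD /= -!/(pr _) mulrDr -Ep -Eq.
    by ring.
  - exists (p' * q + pr p * q').
    rewrite {1}/pr rmorphM /= -!/(pr _) mulrDr mulrA -Ep mulrCA -Eq; ring.
pose pt w k : R :=
  w k - (if k == i then (v ord0 i)^-1 else 0) * (linform v).@[w].
have prE p w : (pr p).@[w] = p.@[pt w].
  change ((meval w \o pr) p = meval (pt w) p).
  apply: mpoly_rmorph_eq => [c|k] /=; first by rewrite /pr mmapC !mevalC.
  by rewrite /pr mmapXU mevalB mevalZ !mevalXU.
have vpt w : (linform v).@[pt w] = 0.
  rewrite [LHS]meval_linform /pt.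
  under eq_bigr => k _ do rewrite mulrBr mulrA.
  rewrite sumrB -mulr_suml -meval_linform (bigD1 i) //= eqxx big1.
    by rewrite addr0 divff // mul1r subrr.
  by move=> k /negPf ->; rewrite mulr0.
(* The product vanishes at every point. Its second factor is nonzero, because [w0] lies on the
   hyperplane and is fixed by the projection. *)
have : pr f * pr g = 0.
  apply: mpoly_eq0_eval => w; rewrite mevalM !prE.
  have [->|gN0] := eqVneq g.@[pt w] 0; first by rewrite mulr0.
  by rewrite fw ?mul0r.
move=> /eqP; rewrite mulf_eq0 => /orP[] /eqP pr0.
  by have := prP f; rewrite pr0 subr0.
suff : g.@[w0] = 0 by move/eqP; rewrite (negPf gw0).
rewrite -[RHS](meval0 w0) -pr0 prE; apply: meval_eq => k.
by rewrite /pt vw0 mulr0 subr0.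
Qed.

Lemma linform_dividesP (R : realType) (n : nat) (v : 'rV[R]_n)
    (f : {mpoly R[n]}) : v != 0 ->
  (forall w, (linform v).@[w] = 0 -> f.@[w] = 0) <-> linform_divides v f.
Proof.
move=> v0; split=> [fw|[q ->] w vw]; last by rewrite mevalM vw mul0r.
apply: (@linform_divides_generic _ _ _ f 1 (fun=> 0)) => //.
- by rewrite meval_linform big1 // => i _; rewrite mulr0.
- by rewrite meval1 oner_eq0.
- by move=> w /fw.
Qed.

Definition proportional (R : realType) (n : nat) (u v : 'rV[R]_n) :=
  forall i j, u ord0 i * v ord0 j = u ord0 j * v ord0 i.

(** The forms are split off one at a time: a form dividing [linform (v i) * g] divides [g], as
    [linform (v i)] does not vanish identically on its hyperplane. *)
Lemma prod_linform_divides (R : realType) (n : nat) (I : eqType) (s : seq I)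
    (v : I -> 'rV[R]_n) (f : {mpoly R[n]}) :
  uniq s -> {in s, forall i, v i != 0} ->
  {in s &, forall i j, proportional (v i) (v j) -> i = j} ->
  {in s, forall i, linform_divides (v i) f} ->
  exists q, f = \prod_(i <- s) linform (v i) * q.
Proof.
elim: s f => [|i s IHs] f /=.
  by move=> _ _ _ _; exists f; rewrite big_nil mul1r.
move=> /andP[iNs us] vN0 vprop fdvd.
have [g Ef] := fdvd i (mem_head _ _).
have sub j : j \in s -> j \in i :: s by rewrite inE orbC => ->.
have [j js|j k js ks|j js|q Eg] := IHs g us.
- exact: vN0 (sub _ js).
- exact: vprop (sub _ js) (sub _ ks).
- have /(linform_dividesP _ (vN0 _ (sub _ js))) fj := fdvd j (sub _ js).
  have [[a b] /= ab] : exists ab : 'I_n * 'I_n,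
      v j ord0 ab.1 * v i ord0 ab.2 - v j ord0 ab.2 * v i ord0 ab.1 != 0.
    apply/existsP; apply: contraNT iNs; rewrite negb_exists => /forallP ab.
    suff <- : j = i by [].
    apply: vprop; rewrite ?mem_head ?sub // => a b.
    by apply/eqP; have := ab (a, b); rewrite negbK subr_eq0.
  (* A point of the hyperplane of [v j] supported on the coordinates [a] and [b]; the value of [v i]
     at it is the nonzero minor. *)
  pose w k := v j ord0 a * (k == b)%:R - v j ord0 b * (k == a)%:R.
  have vw (x : 'rV[R]_n) : (linform x).@[w] =
      v j ord0 a * x ord0 b - v j ord0 b * x ord0 a.
    rewrite meval_linform; under eq_bigr => k _ do rewrite /w mulrBr !mulrA.
    rewrite sumrB (bigD1 b) //= big1 => [|k /negPf ->]; last by rewrite mulr0.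
    rewrite [X in _ - X](bigD1 a) //= big1 => [|k /negPf ->]; last first.
      by rewrite mulr0.
    by rewrite !eqxx !mulr1 !addr0; ring.
  apply: (@linform_divides_generic R n (v j) g (linform (v i)) w).
  + exact: vN0 (sub _ js).
  + by rewrite vw; ring.
  + by rewrite vw.
  + move=> x /fj; rewrite Ef mevalM => /eqP; rewrite mulf_eq0.
    by case/orP=> [->|/eqP].
- by exists q; rewrite big_cons Ef Eg mulrA.
Qed.

(** At each point of the hyperplane the constant vector [v] lies in the kernel of the matrix, so the
    determinant vanishes there. *)
Lemma linform_divides_det (R : realType) (n : nat) (v : 'rV[R]_n)
    (N : 'M[{mpoly R[n]}]_n) : v != 0 ->
  (forall i, linform_divides v (\sum_k N i k * (v ord0 k)%:MP)) ->
  linform_divides v (\det N).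
Proof.
move=> v0 Nv; apply/linform_dividesP => // w vw.
rewrite -det_map_mx -det_tr; apply/eqP/det0P; exists v => //.
apply/rowP => i; rewrite !mxE.
have /linform_dividesP /(_ w vw) := Nv i; rewrite raddf_sum => /(_ v0) Nv0.
rewrite -[RHS]Nv0; apply: eq_bigr => k _; rewrite !mxE /=.
by rewrite mevalM mevalC mulrC.
Qed.

(** * Saito's criterion *)

Lemma dhomog_prod_sum (R : nzRingType) (n : nat) (I : Type) (s : seq I)
    (F : I -> {mpoly R[n]}) (d : I -> nat) :
  (forall i, F i \is (d i).-homog) ->
  \prod_(i <- s) F i \is (\sum_(i <- s) d i).-homog.
Proof.
move=> Fd; elim: s => [|i s IHs]; first by rewrite !big_nil dhomog1.
by rewrite !big_cons dhomogM.
Qed.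

Lemma msize_dhomog (R : nzRingType) (n d : nat) (p : {mpoly R[n]}) :
  p != 0 -> p \is d.-homog -> msize p = d.+1.
Proof.
move=> p0 pd; rewrite -(dhomog_uniq p0 (dhomog_msize pd) pd).
by rewrite prednK // lt0n msize_poly_eq0.
Qed.

Lemma dhomog_det (R : comNzRingType) (n k : nat) (N : 'M[{mpoly R[n]}]_k)
    (e : 'I_k -> nat) :
  (forall i j, N i j \is (e i).-homog) -> \det N \is (\sum_i e i).-homog.
Proof.
move=> Ne; apply: rpred_sum => s _; rewrite -signr_odd.
have: \prod_i N i (s i) \is (\sum_i e i).-homog by apply: dhomog_prod_sum.
by case: odd; rewrite ?expr0 ?mul1r // expr1 mulN1r dhomogN.
Qed.

Definition derivation_of (R : realType) (n : nat) (t : 'I_n -> {mpoly R[n]})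
  (f : {mpoly R[n]}) := \sum_(k < n) t k * mderiv k f.

Lemma derivation_ofX (R : realType) (n : nat) (t : 'I_n -> {mpoly R[n]})
    (i : 'I_n) : derivation_of t 'X_i = t i.
Proof.
rewrite /derivation_of (bigD1 i) //= big1 => [|k ki]; last first.
  by rewrite mderivX mnm1E eq_sym (negPf ki) scale0r mulr0.
rewrite mderivX mnm1E eqxx scale1r addr0.
suff -> : (U_(i) - U_(i))%MM = 0%MM :> 'X_{1..n} by rewrite mpolyX0 mulr1.
by apply/mnmP => k; rewrite mnmBE subnn mnm0E.
Qed.

Lemma derivation_of_derivation (R : realType) (n : nat)
    (t : 'I_n -> {mpoly R[n]}) : derivation (derivation_of t).
Proof.
split=> [c p q|p q]; rewrite /derivation_of.
  rewrite scaler_sumr -big_split; apply: eq_bigr => k _ /=.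
  by rewrite linearP mulrDr scalerAr.
rewrite mulr_suml mulr_sumr -big_split; apply: eq_bigr => k _ /=.
by rewrite mderivM; ring.
Qed.

Lemma derivationE (R : realType) (n : nat)
    (theta : {mpoly R[n]} -> {mpoly R[n]}) : derivation theta ->
  theta =1 derivation_of (fun k => theta 'X_k).
Proof.
move=> [tL tM].
have tD p q : theta (p + q) = theta p + theta q.
  by have := tL 1 p q; rewrite !scale1r.
have [dL dM] := derivation_of_derivation (fun k => theta 'X_k).
have t1 : theta 1 = 0.
  by apply: (addrI (theta 1)); rewrite addr0 -{3}(mulr1 1) tM mulr1 mul1r.
have t0 : theta 0 = 0.
  by apply: (addrI (theta 0)); rewrite addr0 -tD addr0.
apply: mpoly_alg_ind => [c|i|p q Ep Eq|p q Ep Eq].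
- rewrite -[c%:MP]mulr1 mul_mpolyC -(addr0 (c *: 1)) tL t1 t0 scaler0 !addr0.
  rewrite /derivation_of big1 // => k _.
  by rewrite -mul_mpolyC mulr1 mderivC mulr0.
- by rewrite derivation_ofX.
- by rewrite tD Ep Eq -[p in RHS]scale1r dL scale1r.
- by rewrite tM Ep Eq dM.
Qed.

Lemma derivation_linform (R : realType) (n : nat)
    (theta : {mpoly R[n]} -> {mpoly R[n]}) (v : 'rV[R]_n) : derivation theta ->
  theta (linform v) = \sum_(k < n) theta 'X_k * (v ord0 k)%:MP.
Proof.
move=> thetaP; rewrite derivationE // /derivation_of; apply: eq_bigr => k _.
congr (_ * _); rewrite /linform raddf_sum (bigD1 k) //= big1 => [|i ik].
  rewrite addr0 mderivZ mderivX mnm1E eqxx scale1r.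
  suff -> : (U_(k) - U_(k))%MM = 0%MM :> 'X_{1..n}.
    by rewrite mpolyX0 -mul_mpolyC mulr1.
  by apply/mnmP => j; rewrite mnmBE subnn mnm0E.
by rewrite mderivZ mderivX mnm1E (negPf ik) scale0r scaler0.
Qed.

(** All forms divide the coefficient determinant of any n elements of [D A]. For the given family
    the degrees force equality with their product [Q] up to a scalar, and Cramer's rule then
    expresses every element of [D A] in the family. *)
Lemma saito_criterion (R : realType) (n : nat) (A : central_arrangement R n)
    (I : eqType) (s : seq I) (v : I -> 'rV[R]_n)
    (t : 'I_n -> 'I_n -> {mpoly R[n]}) (e : 'I_n -> nat) :
  uniq s -> {in s, forall i, v i != 0} ->
  {in s &, forall i j, proportional (v i) (v j) -> i = j} ->
  {in s, forall i, A (v i)} ->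
  (forall i, D A (derivation_of (t i))) ->
  (forall i k, t i k \is (e i).-homog) ->
  (\sum_i e i = size s)%N -> \det (\matrix_(i, k) t i k) != 0 ->
  D_basis A (fun i => derivation_of (t i)).
Proof.
move=> us vN0 vprop vA tA te es; set N := \matrix_(i, k) t i k => detN0.
pose Q := \prod_(i <- s) linform (v i).
have Qdvd (M : 'M[{mpoly R[n]}]_n) :
    (forall i, D A (derivation_of (M i))) -> exists q, \det M = Q * q.
  move=> MA; apply: prod_linform_divides => // i si.
  apply: linform_divides_det; first exact: vN0.
  move=> k; have [Mk /(_ _ (vA _ si))] := MA k.
  rewrite derivation_linform // => -[q Eq]; exists q; rewrite -Eq.
  by apply: eq_bigr => j _; rewrite derivation_ofX.
have QN0 : Q != 0.
  rewrite /Q big_seq prodf_seq_neq0; apply/allP => i si; apply/implyP => _.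
  apply: contraNneq (vN0 _ si) => vi0; apply/eqP/rowP => k.
  rewrite mxE -[LHS](_ : (linform (v i)).@[fun j => (j == k)%:R] = _).
    by rewrite vi0 meval0.
  rewrite meval_linform (bigD1 k) //= eqxx mulr1 big1 ?addr0 // => j /negPf ->.
  by rewrite mulr0.
have Qhom : Q \is (size s).-homog.
  have -> : size s = (\sum_(i <- s) 1)%N by rewrite sum1_size.
  apply: dhomog_prod_sum => i; apply: rpred_sum => k _.
  by apply: rpredZ; rewrite dhomogX; apply/eqP; exact: mdeg1.
have [c c0 detE] : exists2 c, c != 0 & \det N = c *: Q.
  have [|q Eq] := Qdvd N.
    by move=> i; have := tA i; congr (D A (derivation_of _));
       apply: boolp.funext => k; rewrite mxE.
  have qN0 : q != 0 by apply: contraNneq detN0 => q0; rewrite Eq q0 mulr0.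
  have : msize (\det N) = (size s).+1.
    rewrite (msize_dhomog (d := (\sum_i e i)%N)) ?es // -es.
    by apply: dhomog_det => i k; rewrite mxE.
  rewrite Eq msizeM // (msize_dhomog QN0 Qhom) addSn /= => szq.
  have /msize_poly1P[c c0 Ec] : msize q == 1%N by rewrite -(eqn_add2l (size s)) szq addn1.
  by exists c => //; rewrite Ec mulrC mul_mpolyC.
split=> [//|theta thetaA|r r0 i].
- have [thetaD _] := thetaA.
  pose r := \row_k theta 'X_k.
  (* Cramer's rule: row [i] of [N] is replaced by the coefficients of [theta], and the determinant
     stays divisible by [Q]. *)
  pose Nr i : 'M_n := \matrix_(j, k) if j == i then theta 'X_k else t j k.
  have NrE i : \det (Nr i) = (r *m \adj N) ord0 i.
    rewrite (expand_det_row _ i) mxE; apply: eq_bigr => k _.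
    rewrite !mxE eqxx; congr (_ * _); rewrite /cofactor; congr (_ * \det _).
    by apply/matrixP => a b; rewrite !mxE eq_sym (negPf (neq_lift _ _)).
  have /fin_all_exists [q Eq] i : exists q, \det (Nr i) = Q * q.
    apply: Qdvd => j; have [->|ji] := eqVneq j i.
      have -> : derivation_of (Nr i i) = theta; last by [].
      apply: boolp.funext => f; rewrite (derivationE thetaD).
      by apply: eq_bigr => k _; rewrite mxE eqxx.
    have := tA j; congr (D A (derivation_of _)).
    by apply: boolp.funext => k; rewrite mxE (negPf ji).
  exists (fun i => c^-1 *: q i) => f.
  rewrite (derivationE thetaD) {1}/derivation_of.
  under [RHS]eq_bigr => i _ do rewrite /derivation_of mulr_sumr.
  rewrite exchange_big; apply: eq_bigr => k _ /=.
  under eq_bigr => i _ do rewrite mulrA.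
  rewrite -mulr_suml; congr (_ * _).
  have cQN0 : c *: Q != 0 by rewrite -detE.
  apply: (mulfI cQN0); rewrite -detE.
  have -> : \det N * theta 'X_k = (r *m \adj N *m N) ord0 k.
    by rewrite -mulmxA mul_adj_mx mul_mx_scalar !mxE.
  rewrite mxE mulr_sumr; apply: eq_bigr => i _.
  rewrite -NrE Eq detE mxE mulrA -scalerAl -scalerAr scalerA divff //.
  by rewrite scale1r.
- pose rr := \row_i r i.
  have rN : rr *m N = 0.
    apply/rowP => k; rewrite !mxE -[RHS](r0 'X_k).
    by apply: eq_bigr => j _; rewrite !mxE derivation_ofX.
  have := congr1 (mulmx^~ (\adj N)) rN.
  rewrite /= -mulmxA mul_mx_adj mul_mx_scalar mul0mx => /rowP /(_ i).
  by rewrite !mxE => /eqP; rewrite mulf_eq0 (negPf detN0) => /eqP.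
Qed.

(** * Difference calculus *)

Section TwistedPolynomials.
Variables (A : comNzRingType) (nu : int -> A).
Implicit Types (c : A) (cs : seq A) (w : int -> A) (M E : int).

(* If the sequence [k] satisfies k (M + 1) = k M * (T - nu M), then
   [tstep c k] is (T - c) * k. *)
Definition tstep c w M := w (M + 1) + (nu M - c) * w M.
(** If a linear functional takes the value [w M] on [k M], its value on [k M] times the product of
    the [T - c] is [tprod cs w M]. The functional will be antidifferentiation, and [k] the kernel
    [kap]. *)
Definition tprod cs w := foldr tstep w cs.

Lemma tstepC c d w : tstep c (tstep d w) = tstep d (tstep c w).
Proof. by apply: funext => M; rewrite /tstep; ring. Qed.

Lemma tprod_step cs c w : tprod cs (tstep c w) = tstep c (tprod cs w).
Proof. by elim: cs => //= d cs ->; rewrite tstepC. Qed.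

Lemma tprod_cat cs ds w : tprod (cs ++ ds) w = tprod cs (tprod ds w).
Proof. exact: foldr_cat. Qed.

Lemma tprodC cs ds w : tprod cs (tprod ds w) = tprod ds (tprod cs w).
Proof. by elim: cs => //= c cs ->; rewrite tprod_step. Qed.

Lemma tprod_perm cs ds w : perm_eq cs ds -> tprod cs w = tprod ds w.
Proof.
move=> cd; pose P s := tprod s w = tprod cs w.
apply/esym; rewrite -/(P ds); apply: (@catCA_perm_ind _ P _ cs ds) => //.
by move=> s1 s2 s3; rewrite /P !tprod_cat tprodC.
Qed.

(** [tstep] looks only upwards in the index. This matters because the identities for negative
    indices hold only from some bound on. *)
Lemma eq_tprod E cs w w' : (forall M, E <= M -> w M = w' M) ->
  forall M, E <= M -> tprod cs w M = tprod cs w' M.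
Proof.
move=> ww'; elim: cs => [|c cs IHcs] M EM /=; first exact: ww'.
by rewrite /tstep !IHcs //; lia.
Qed.

Lemma tprod_lin cs (a b : A) w w' M :
  tprod cs (fun M => a * w M + b * w' M) M = a * tprod cs w M + b * tprod cs w' M.
Proof. by elim: cs M => //= c cs IHcs M; rewrite /tstep !IHcs; ring. Qed.

Lemma tprod_eq0 E cs w : (forall M, E <= M -> w M = 0) ->
  forall M, E <= M -> tprod cs w M = 0.
Proof.
move=> w0; elim: cs => [|c cs IHcs] M EM /=; first exact: w0.
by rewrite /tstep !IHcs ?mulr0 ?addr0 //; lia.
Qed.

(** For numbers satisfying the recursion, the formal factors [T - c] become actual ones. *)
Lemma tprod_eigen E cs w (T : A) :
  (forall M, E <= M -> w (M + 1) = w M * (T - nu M)) ->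
  forall M, E <= M -> tprod cs w M = w M * \prod_(c <- cs) (T - c).
Proof.
move=> wT; elim: cs => [|c cs IHcs] M EM /=; first by rewrite big_nil mulr1.
by rewrite /tstep !IHcs ?wT ?big_cons; [ring|lia..].
Qed.

End TwistedPolynomials.

Lemma tprod_rmorph (A B : comNzRingType) (f : {rmorphism A -> B}) (nu : int -> A)
    (cs : seq A) (w : int -> A) (M : int) :
  f (tprod nu cs w M) = tprod (f \o nu) (map f cs) (f \o w) M.
Proof.
elim: cs M => //= c cs IHcs M.
by rewrite /tstep rmorphD rmorphM rmorphB !IHcs.
Qed.

(** * Products over symmetric windows of an arithmetic progression *)

Section Hprod.
Variables (A : comNzRingType) (h : A).
Implicit Types (t : A) (M : nat).

Definition hprod M t := \prod_(i < (2 * M).+1) (t + (M%:R - i%:R) * h).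

Lemma hprod0 t : hprod 0 t = t.
Proof. by rewrite /hprod big_ord_recl big_ord0 /=; ring. Qed.

Lemma hprodS M t : hprod M.+1 t = hprod M t * (t ^+ 2 - (M.+1%:R * h) ^+ 2).
Proof.
rewrite /hprod mulnS big_ord_recl big_ord_recr /=.
under eq_bigr => i _ do rewrite /bump /= add1n -!natr1 opprD addrACA subrr addr0.
by rewrite /bump /= -!natr1 natrM; ring.
Qed.

Lemma hprod_shiftS M t :
  hprod M.+1 (t + h) = hprod M t * ((t + M.+1%:R * h) * (t + M.+2%:R * h)).
Proof.
rewrite {1}/hprod mulnS 2!big_ord_recl /= /hprod.
under eq_bigr => i _.
  rewrite /bump /= !natrD -natr1.
  have -> : t + h + (M%:R + 1 - (1 + (1 + i%:R))) * h = t + (M%:R - i%:R) * h.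
    by ring.
  over.
by rewrite /bump /= -!natr1; ring.
Qed.

Lemma hprodN M t : hprod M (- t) = - hprod M t.
Proof.
by elim: M => [|M IHM]; rewrite ?hprod0 // !hprodS IHM; ring.
Qed.

Lemma hprod_unshiftS M t :
  hprod M.+1 t = hprod M (t + h) * ((t - M.+1%:R * h) * (t - M%:R * h)).
Proof.
rewrite -[in LHS](opprK t) hprodN.
have -> : - t = - (t + h) + h by ring.
by rewrite hprod_shiftS hprodN -!natr1; ring.
Qed.

End Hprod.

(** The sequence [nu] that belongs to [kap]: [kap (M + 1) t] is [kap M t * (t ^+ 2 - node h M)]. *)
Definition node (A : comNzRingType) (h : A) (M : int) : A := (M%:~R * h) ^+ 2.

Definition shifts (A : comNzRingType) (h : A) (a : nat) (y : A) : seq A :=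
  [seq (y + (2 * i%:R - a%:R + 1) * h) ^+ 2 | i <- iota 0 a].

(** * Antidifferences at regular points *)

Section RationalSums.
Variables (R : numFieldType) (h : R).
Implicit Types (t y : R) (M : int) (N a : nat) (cs : seq R).

(** No factor of [hprod h N t] vanishes at such a point, so [psi M t] is a true reciprocal for -1 -
    N <= M < 0. *)
Definition regular N t := forall j : int, `|j| <= N%:Z -> t + j%:~R * h != 0.

Lemma regularW N N' t : (N' <= N)%N -> regular N t -> regular N' t.
Proof. by move=> NN' tN j jN'; apply: tN; lia. Qed.

Lemma regular_shift N N' t (r : int) :
  `|r| + N'%:Z <= N%:Z -> regular N t -> regular N' (t + r%:~R * h).
Proof.
by move=> rN tN j jN'; rewrite -addrA -mulrDl -intrD; apply: tN; lia.
Qed.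

Lemma regularN N t : regular N t -> regular N (- t).
Proof.
move=> tN j jN; rewrite -oppr_eq0 opprD opprK -mulNr -mulrNz; apply: tN; lia.
Qed.

Lemma regular_neq0 N t : regular N t -> t != 0.
Proof. by move=> /(_ 0 isT); rewrite mul0r addr0. Qed.

Lemma hprod_neq0 N n t : (n <= N)%N -> regular N t -> hprod h n t != 0.
Proof.
move=> nN tN; apply/prodf_neq0 => i _.
have -> : n%:R - i%:R = (n%:Z - i%:Z)%:~R :> R by rewrite intrB.
by apply: tN; have := ltn_ord i; lia.
Qed.

Lemma hprod_regular N t : hprod h N t != 0 -> regular N t.
Proof.
move=> /prodf_neq0 tN j jN.
have iN : (`|N%:Z - j| < (2 * N).+1)%N by lia.
have := tN (Ordinal iN) isT; rewrite /=; congr (t + _ * h != 0).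
by rewrite !pmulrn -intrB; congr (_%:~R); lia.
Qed.

(* The analogue of t ^ (2 M + 1) for the difference operator
   F |-> F (t + h) - F (t - h). *)
Definition psi M t :=
  match M with Posz n => hprod h n t | Negz n => (hprod h n t)^-1 end.

Lemma psiN M t : psi M (- t) = - psi M t.
Proof. by case: M => n /=; rewrite hprodN // invrN. Qed.

Lemma psiS N M t : regular N t -> - N%:Z <= M ->
  psi (M + 1) t = psi M t * (t ^+ 2 - ((M + 1)%:~R * h) ^+ 2).
Proof.
move=> tN; case: M => [n|[|n]] NM.
- have -> : Posz n + 1 = Posz n.+1 by lia.
  exact: hprodS.
- have -> : Negz 0 + 1 = 0 :> int by [].
  rewrite /= !hprod0 mul0r expr0n subr0 expr2 mulKf //.
  exact: regular_neq0 tN.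
- have -> : Negz n.+1 + 1 = Negz n by lia.
  have tn : hprod h n.+1 t != 0 by apply: hprod_neq0 tN; lia.
  move: tn; rewrite /= hprodS NegzE mulrNz mulNr sqrrN -pmulrn mulf_eq0.
  rewrite negb_or => /andP[n0 n1].
  by rewrite invfM mulfVK.
Qed.

Lemma psi_shift N M t : regular N t -> - N%:Z <= M ->
  psi (M + 1) (t + h)
  = psi M t * ((t + (M + 1)%:~R * h) * (t + (M + 2)%:~R * h)).
Proof.
move=> tN; case: M => [n|[|n]] NM.
- have -> : Posz n + 1 = Posz n.+1 by lia.
  have -> : Posz n + 2 = Posz n.+2 by lia.
  exact: hprod_shiftS.
- have -> : Negz 0 + 1 = 0 :> int by [].
  have -> : Negz 0 + 2 = 1 :> int by [].
  by rewrite /= !hprod0 mul0r mul1r addr0 mulKf //; exact: regular_neq0 tN.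
- have -> : Negz n.+1 + 1 = Negz n by lia.
  have -> : Negz n.+1 + 2 = - n%:Z by lia.
  have tn : hprod h n.+1 t != 0 by apply: hprod_neq0 tN; lia.
  move: tn; rewrite /= hprod_unshiftS NegzE !mulrNz !mulNr -!pmulrn mulf_eq0.
  by rewrite negb_or => /andP[n0 n1]; rewrite invfM mulfVK.
Qed.

Lemma psi_unshift N M t : regular N t -> - N%:Z <= M ->
  psi (M + 1) (t - h)
  = psi M t * ((t - (M + 1)%:~R * h) * (t - (M + 2)%:~R * h)).
Proof.
move=> /regularN tN NM; rewrite -[t - h]opprK psiN opprB [h - t]addrC.
by rewrite (psi_shift tN) // psiN; ring.
Qed.

Definition kap M t := t * psi (M - 1) t.

Lemma kapS N M t : regular N t -> - N%:Z < M ->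
  kap (M + 1) t = kap M t * (t ^+ 2 - (M%:~R * h) ^+ 2).
Proof.
move=> tN NM; rewrite /kap addrK -{1}(subrK 1 M) (psiS tN) ?subrK ?mulrA //; lia.
Qed.

(** For odd [a] this is (psi_M(t + h) + psi_M(t - h)) / (2M + 1), an antidifference of the two
    shifted kernels, written with values at [t] only. *)
Definition lam a M t :=
  if odd a then
    2 * psi M t / (2 * M%:~R + 1) + 2 * M%:~R * h ^+ 2 * psi (M - 1) t
  else psi M t / (2 * M%:~R + 1).

Definition kaps a M t := if odd a then kap M (t + h) + kap M (t - h) else kap M t.

Lemma odd_int_neq0 M : 2 * M%:~R + 1 != 0 :> R.
Proof.
rewrite -[2]/(2%:~R) -intrM -[1]/(1%:~R) -intrD intr_eq0; lia.
Qed.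

Lemma lamN a M t : lam a M (- t) = - lam a M t.
Proof. by rewrite /lam; case: odd; rewrite !psiN; ring. Qed.

Lemma lam_diff N a M t : regular N t -> 2 - N%:Z <= M ->
  lam a M (t + h) - lam a M (t - h) = 2 * h * kaps a M t.
Proof.
move=> tN NM; have M0 := odd_int_neq0 M.
(* Everything is expressed by [psi (M - 1) t] and [psi (M - 2) t]; the lower bound on [M] comes from
   the latter. *)
have e1 : psi M (t + h) =
    psi (M - 1) t * ((t + M%:~R * h) * (t + (M%:~R + 1) * h)).
  have := psi_shift (M := M - 1) tN; rewrite subrK => ->; last by lia.
  by rewrite (_ : M - 1 + 2 = M + 1) ?intrD //; lia.
have e2 : psi M (t - h) =
    psi (M - 1) t * ((t - M%:~R * h) * (t - (M%:~R + 1) * h)).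
  have := psi_unshift (M := M - 1) tN; rewrite subrK => ->; last by lia.
  by rewrite (_ : M - 1 + 2 = M + 1) ?intrD //; lia.
have e3 : psi (M - 1) (t + h) =
    psi (M - 2) t * ((t + (M%:~R - 1) * h) * (t + M%:~R * h)).
  have := psi_shift (M := M - 2) tN; rewrite (_ : M - 2 + 1 = M - 1) ?subrK;
    last by lia.
  by move=> ->; rewrite ?intrB //; lia.
have e4 : psi (M - 1) (t - h) =
    psi (M - 2) t * ((t - (M%:~R - 1) * h) * (t - M%:~R * h)).
  have := psi_unshift (M := M - 2) tN; rewrite (_ : M - 2 + 1 = M - 1) ?subrK;
    last by lia.
  by move=> ->; rewrite ?intrB //; lia.
have e5 : psi (M - 1) t = psi (M - 2) t * (t ^+ 2 - ((M%:~R - 1) * h) ^+ 2).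
  have := psiS (M := M - 2) tN; rewrite (_ : M - 2 + 1 = M - 1); last by lia.
  by move=> ->; rewrite ?intrB //; lia.
rewrite /lam /kaps; case: odd; rewrite /kap e1 e2 ?e3 ?e4 e5; field; exact: M0.
Qed.

(** Two more shifts add the extreme offsets and keep the others, hence the induction by steps of two
    below. *)
Lemma shiftsSS a y : perm_eq (shifts h a.+2 y)
  ((y - (a%:R + 1) * h) ^+ 2 :: (y + (a%:R + 1) * h) ^+ 2 :: shifts h a y).
Proof.
have -> : shifts h a.+2 y = (y - (a%:R + 1) * h) ^+ 2 ::
    (shifts h a y ++ [:: (y + (a%:R + 1) * h) ^+ 2]).
  rewrite /shifts -(addn1 a.+1) iotaD map_cat /= add0n (iotaDl 1 0) -map_comp.
  congr (_ :: _ ++ [:: _]); [|apply: eq_map => i /=|];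
  by rewrite -addn1 -(addn1 a) !natrD; congr (_ ^+ 2); ring.
by rewrite perm_cons perm_catC.
Qed.

(** The integral of u^(2M) (u^2 - 1)^a from 0 to 1, continued analytically to negative M, and
    doubled for odd [a], where the kernel is a sum of two shifts. *)
Definition beta a M : R :=
  (if odd a then 2 else 1) * (- 2) ^+ a * a`!%:R
  / \prod_(i < a.+1) (2 * M%:~R + 2 * i%:R + 1).

Let factor M i : R := 2 * M%:~R + 2 * i%:R + 1.

Let factor_neq0 M i : factor M i != 0.
Proof.
have := odd_int_neq0 (M + i%:Z); congr (_ != 0).
by rewrite /factor intrD; ring.
Qed.

Let prod_factor_neq0 a M : \prod_(i < a) factor M i != 0.
Proof. by apply/prodf_neq0 => i _; exact: factor_neq0. Qed.

Lemma betaS a M : beta a (M + 1) * (2 * M%:~R + 2 * a%:R + 3) =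
  beta a M * (2 * M%:~R + 1).
Proof.
have E : \prod_(i < a.+1) factor M i * (2 * M%:~R + 2 * a%:R + 3) =
    (2 * M%:~R + 1) * \prod_(i < a.+1) factor (M + 1) i.
  have -> : 2 * M%:~R + 2 * a%:R + 3 = factor M a.+1.
    by rewrite /factor -(addn1 a) natrD; ring.
  transitivity (\prod_(i < a.+2) factor M i); first by rewrite [RHS]big_ord_recr.
  rewrite big_ord_recl.
  congr (_ * _); first by rewrite /factor mulr0 addr0.
  by apply: eq_bigr => i _; rewrite /factor lift0 -addn1 natrD intrD mulr1z; ring.
have P0 := prod_factor_neq0 a.+1 M; have P1 := prod_factor_neq0 a.+1 (M + 1).
rewrite /beta -!/(factor _ _) -[LHS]mulrA -[RHS]mulrA; congr (_ * _).
move: P0 P1 E; set p := \prod_(i < _) factor M i; set q := \prod_(i < _) _ => P0 P1 E.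
apply: (mulfI P0); apply: (mulfI P1).
by rewrite [LHS]mulrCA !mulVKf // E mulrC.
Qed.

Lemma betaSS a M : beta a.+2 M =
  beta a M * (4 * (a%:R + 1) * (a%:R + 2))
  / ((2 * M%:~R + 2 * a%:R + 3) * (2 * M%:~R + 2 * a%:R + 5)).
Proof.
rewrite /beta /= negbK !big_ord_recr /= -!/(factor _ _).
have P0 := prod_factor_neq0 a M.
have := factor_neq0 M a; have := factor_neq0 M a.+1; have := factor_neq0 M a.+2.
rewrite /factor !factS !natrM !exprS -(addn1 a.+1) -(addn1 a) !natrD => f2 f1 f0.
field; rewrite P0 f0 !andbT.
by apply/andP; split; [move: f2 | move: f1]; congr (_ != 0); ring.
Qed.

(* The rank one case: up to a constant, the antidifference at t = y of the
   product of all t ^ 2 - c, c in [shifts h a y], with [kaps a M]. *)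
Lemma tprod_shifts_lam N a M y : regular N y -> 1 - N%:Z <= M ->
  tprod (node h) (shifts h a y) (fun M => lam a M y) M = beta a M * psi (M + a%:Z) y.
Proof.
move=> yN; elim/ltn_ind: a M => -[_|[_|a IHa]] M NM.
- rewrite /= /lam /beta /= expr0 fact0 !mul1r big_ord_recl big_ord0 /=.
  by rewrite mulr0 addr0 mulr1 addr0 mulrC.
- have M0 := odd_int_neq0 M; have M1 := odd_int_neq0 (M + 1).
  rewrite /= /tstep /lam /beta /= addrK /node !big_ord_recl big_ord0 /=.
  have e1 : psi (M + 1) y = psi M y * (y ^+ 2 - ((M%:~R + 1) * h) ^+ 2).
    by rewrite (psiS yN) ?intrD //; lia.
  have e2 : psi M y = psi (M - 1) y * (y ^+ 2 - (M%:~R * h) ^+ 2).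
    by rewrite -{1 3}(subrK 1 M) (psiS yN) //; lia.
  rewrite e1 e2; move: M1; rewrite intrD /bump /= => M1.
  rewrite addn0 (_ : 1`! = 1%N) //; field; rewrite M0 andbT.
  by move: M1; congr (_ != 0); ring.
(* The two outer factors raise the index by up to two; the closed forms for [a] at M, M + 1 and M +
   2 combine to the one for a + 2. *)
- rewrite (tprod_perm _ _ (shiftsSS a y)) /=.
  have lamSS : (fun M => lam a.+2 M y) = (fun M => lam a M y).
    by apply: funext => E; rewrite /lam /= negbK.
  rewrite lamSS /tstep !IHa //; try lia.
  have e1 : psi (M + 1 + a%:Z) y =
      psi (M + a%:Z) y * (y ^+ 2 - ((M%:~R + a%:R + 1) * h) ^+ 2).
    rewrite addrAC (psiS yN) ?intrD -?pmulrn //; lia.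
  have e2 : psi (M + 1 + 1 + a%:Z) y =
      psi (M + 1 + a%:Z) y * (y ^+ 2 - ((M%:~R + a%:R + 2) * h) ^+ 2).
    rewrite addrAC (psiS yN); last by lia.
    rewrite !intrD -?pmulrn; congr (_ * (_ - (_ * _) ^+ _)); ring.
  have e3 : psi (M + a.+2%:Z) y =
      psi (M + 1 + a%:Z) y * (y ^+ 2 - ((M%:~R + a%:R + 2) * h) ^+ 2).
    by rewrite -e2; congr psi; lia.
  have M1 : 2 * M%:~R + 2 * a%:R + 3 != 0 :> R.
    by have := odd_int_neq0 (M + a%:Z + 1); congr (_ != 0); rewrite !intrD; ring.
  have M2 : 2 * M%:~R + 2 * a%:R + 5 != 0 :> R.
    by have := odd_int_neq0 (M + a%:Z + 2); congr (_ != 0); rewrite !intrD; ring.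
  have b1 := canRL (mulfK M1) (betaS a M).
  have b2 : beta a (M + 1 + 1) =
      beta a (M + 1) * (2 * M%:~R + 3) / (2 * M%:~R + 2 * a%:R + 5).
    rewrite -[LHS](mulfK M2); congr (_ / _).
    have := betaS a (M + 1); rewrite intrD mulr1z => E.
    by etransitivity; [|etransitivity; [exact: E|]]; congr (_ * _); ring.
  by rewrite e3 e2 e1 betaSS b2 b1 /node !intrD; field; rewrite M1 M2.
Qed.

(** Up to the factor 2h, an antidifference of the full integrand: by linearity the factors [T - c]
    may be applied after antidifferentiation. *)
Definition antidiff a cs M t := tprod (node h) cs (fun M => lam a M t) M.

Lemma antidiffN a cs M t : antidiff a cs M (- t) = - antidiff a cs M t.
Proof.
have := tprod_lin (node h) cs (-1) 0 (lam a ^~ t) (lam a ^~ t) M.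
rewrite mul0r addr0 mulN1r => <-.
congr (tprod _ _ _ _); apply: funext => E.
by rewrite lamN mul0r addr0 mulN1r.
Qed.

Lemma tprod_kap N cs M t : regular N t -> - N%:Z < M ->
  tprod (node h) cs (kap^~ t) M = kap M t * \prod_(c <- cs) (t ^+ 2 - c).
Proof.
move=> tN NM; apply: (@tprod_eigen _ (node h) M cs (kap^~ t)) => // E ME.
by rewrite (kapS tN) // (lt_le_trans NM).
Qed.

(** The difference of both sides is 2h times the integrand at [t], for odd [a] the sum of its values
    at [t + h] and [t - h], where some factor [T - c] vanishes. *)
Lemma antidiff_step N a cs M t : regular N.+1 t -> 1 - N%:Z <= M ->
  (odd a -> (t + h) ^+ 2 \in cs /\ (t - h) ^+ 2 \in cs) ->
  (~~ odd a -> t ^+ 2 \in cs) ->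
  antidiff a cs M (t + h) = antidiff a cs M (t - h).
Proof.
move=> tN NM modd meven; apply/eqP; rewrite -subr_eq0; apply/eqP.
have kap0 u : regular N u -> u ^+ 2 \in cs -> tprod (node h) cs (kap^~ u) M = 0.
  move=> uN ucs; rewrite (tprod_kap _ uN); last by lia.
  by rewrite (big_rem _ ucs) /= subrr mul0r mulr0.
(* The summand [0 * 0] only gives the sequence the shape required by [tprod_lin]. *)
have -> : antidiff a cs M (t + h) - antidiff a cs M (t - h) =
    tprod (node h) cs (fun M => 2 * h * kaps a M t + 0 * 0) M.
  have := tprod_lin (node h) cs 1 (-1) (lam a ^~ (t + h)) (lam a ^~ (t - h)) M.
  rewrite mul1r mulN1r => <-; apply: (@eq_tprod _ _ M) => // E ME.
  by rewrite mul1r mulN1r (lam_diff _ tN) ?mul0r ?addr0 //; lia.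
rewrite (tprod_lin _ _ (2 * h) 0 (kaps a ^~ t) (fun=> 0)) mul0r addr0.
rewrite /kaps; case: (boolP (odd a)) => [ao|ae] /=.
  have [pcs mcs] := modd ao.
  have -> : (fun E => kap E (t + h) + kap E (t - h)) =
      fun E => 1 * kap E (t + h) + 1 * kap E (t - h).
    by apply: funext => E; rewrite !mul1r.
  have rp : regular N (t + h).
    by rewrite -[h]mul1r; apply: (regular_shift (r := 1) _ tN); lia.
  have rm : regular N (t - h).
    by rewrite -mulN1r; apply: (regular_shift (r := -1) _ tN); lia.
  by rewrite (tprod_lin _ _ _ _ (kap ^~ (t + h)) (kap ^~ (t - h))) !kap0 ?mulr0 ?addr0 ?mulr0 //.
by rewrite kap0 ?mulr0 ?meven //; apply: regularW tN; lia.
Qed.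

(* Each lattice point between t and t + 2 s h is within a shift by q,
   2 |q| < a, of one of the two ends: this is where s <= a is used. *)
Lemma antidiff_shift N a (s : nat) cs M t :
  regular N t -> (2 * s < N)%N -> (s <= a)%N -> 2 + 2 * s%:Z - N%:Z <= M ->
  {subset shifts h a t <= cs} -> {subset shifts h a (t + 2 * s%:R * h) <= cs} ->
  antidiff a cs M (t + 2 * s%:R * h) = antidiff a cs M t.
Proof.
move=> tN sN sa NM lcs rcs.
(* [k] counts steps of length [h] from [t], with the parity of the offsets. For k < a the point is a
   shift of [t], for k >= a one of the other end, because 2s - a <= a. For odd [a] the end k = 2s is
   met as well. *)
have mem_cs (k : int) : (0 <= k < 2 * s%:Z) || (k == 2 * s%:Z) && odd a ->
    odd a = ~~ odd `|k| -> (t + k%:~R * h) ^+ 2 \in cs.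
  move=> ks ak.
  have [kl|kr] := ltP k a%:Z.
    have [i Ei] : exists i : nat, k = 2 * i%:Z - a%:Z + 1.
      by exists (absz (k + a%:Z - 1)%R %/ 2)%N; lia.
    apply: lcs; apply/mapP; exists i; first by rewrite mem_iota; lia.
    by rewrite Ei intrD intrB intrM.
  have [i Ei] : exists i : nat, k - 2 * s%:Z = 2 * i%:Z - a%:Z + 1.
    by exists (absz (k - 2 * s%:Z + a%:Z - 1)%R %/ 2)%N; lia.
  apply: rcs; apply/mapP; exists i; first by rewrite mem_iota; lia.
  rewrite [in LHS](_ : k = 2 * s%:Z + (2 * i%:Z - a%:Z + 1)); last by lia.
  by rewrite !(intrD, intrB, intrM); congr (_ ^+ 2); ring.
suff H r : (r <= s)%N -> antidiff a cs M (t + 2 * r%:R * h) = antidiff a cs M t.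
  exact: H.
elim: r => [|r IHr] rs; first by rewrite mulr0 mul0r addr0.
rewrite -IHr; last exact: ltnW.
have kr : regular (N - 2 * s - 1).+1 (t + (2 * r%:Z + 1)%:~R * h).
  by apply: (regular_shift _ tN); lia.
have := antidiff_step (a := a) (cs := cs) (M := M) kr.
have -> : t + (2 * r%:Z + 1)%:~R * h + h = t + (2 * r%:Z + 2)%:~R * h.
  by rewrite !intrD; ring.
have -> : t + (2 * r%:Z + 1)%:~R * h - h = t + (2 * r%:Z)%:~R * h.
  by rewrite !intrD; ring.
move=> step; move: step.
have -> : t + 2 * r.+1%:R * h = t + (2 * r%:Z + 2)%:~R * h.
  by rewrite -natr1 !(intrD, intrM) -?pmulrn; ring.
have -> : t + 2 * r%:R * h = t + (2 * r%:Z)%:~R * h by rewrite intrM.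
by apply; [lia | move=> ao; split; apply: mem_cs; lia | move=> ae; apply: mem_cs; lia].
Qed.

Lemma shiftsN a y : shifts h a (- y) =i shifts h a y.
Proof.
suff sub x : {subset shifts h a (- x) <= shifts h a x}.
  by move=> c; apply/idP/idP => [/sub//|]; rewrite -{1}(opprK y) => /sub.
move=> c /mapP[i]; rewrite mem_iota /= add0n => ia ->; apply/mapP.
(* Reversing the order negates the offsets, and the square absorbs the sign. *)
exists (a.-1 - i)%N; first by rewrite mem_iota; lia.
rewrite natrB; last by lia.
have -> : a%:R = a.-1%:R + 1 :> R by rewrite natr1 prednK //; lia.
by ring.
Qed.

Lemma antidiff_eq N a (s : int) cs M t u :
  regular N t -> regular N u -> (2 * a < N)%N -> `|s| <= a%:Z -> u = t + 2 * s%:~R * h ->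
  2 + 2 * a%:Z - N%:Z <= M ->
  {subset shifts h a t <= cs} -> {subset shifts h a u <= cs} ->
  antidiff a cs M u = antidiff a cs M t.
Proof.
move=> tN uN aN sa Eu NM tcs ucs; case: s sa Eu => s sa Eu.
  rewrite Eu; apply: (antidiff_shift tN); rewrite -?Eu //; lia.
have Et : t = u + 2 * s.+1%:R * h.
  by rewrite Eu NegzE mulrNz -pmulrn; ring.
rewrite Et; apply/esym; apply: (antidiff_shift uN); rewrite -?Et //; lia.
Qed.

End RationalSums.

(** * Independence at infinity *)

Lemma dvdp_prod_XsubC_exp (R : fieldType) (s : seq R) (k : nat) (p : {poly R}) :
  uniq s -> {in s, forall r, ('X - r%:P) ^+ k %| p} ->
  \prod_(r <- s) ('X - r%:P) ^+ k %| p.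
Proof.
elim: s => [|r s IHs] /=; first by rewrite big_nil dvd1p.
move=> /andP[rs us] sp; rewrite big_cons Gauss_dvdp.
  rewrite sp ?mem_head // IHs // => q qs; apply: sp.
  by rewrite inE qs orbT.
rewrite coprimep_expl // big_seq; apply: (big_ind (coprimep ('X - r%:P))).
- exact: coprimep1.
- by move=> q q' qr q'r; rewrite coprimepMr qr.
move=> q qs; rewrite coprimep_expr // coprimep_XsubC root_XsubC.
by apply: contraNneq rs => <-.
Qed.

Lemma hprod_h0 (A : comNzRingType) (n : nat) (t : A) :
  hprod 0 n t = t ^+ (2 * n).+1.
Proof.
elim: n => [|n IHn]; first by rewrite hprod0.
by rewrite hprodS IHn mulr0 expr0n subr0 mulnS -exprD addnC.
Qed.

Lemma regular_h0 (R : numFieldType) (N : nat) (t : R) :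
  t != 0 -> regular 0 N t.
Proof. by move=> t0 j _; rewrite mulr0 addr0. Qed.

Section Independence.
Variables (R : numFieldType) (l a : nat) (x : 'I_l -> R) (E : int).
Hypotheses (x_neq0 : forall i, x i != 0) (x2_inj : injective (fun i => x i ^+ 2)).

Let cs := flatten [seq shifts 0 a (x k) | k <- enum 'I_l].

(* 2 T d/dT + (2 E + 1), that is, t^(-2E) d/dt t^(2E+1) in terms of T = t^2. *)
Let L (p : {poly R}) := 2 *: ('X * p^`()) + (2 * E%:~R + 1) *: p.

(** For M >= E this is t^(2M+1) / (2M+1) divided by t^(2E+1), in terms of T. Below [E] the absolute
    value gives a wrong exponent, but such indices never enter [Phi]. *)
Let monom (M : int) : {poly R} := (2 * M%:~R + 1)^-1 *: 'X^(absz (M - E)).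
(** F_(E+j)(t) / t^(2E+1) as a polynomial in T, up to the factor 2 of odd [a]. *)
Let Phi (j : nat) := tprod (fun=> 0) (map polyC cs) monom (E + j%:Z).

Let LD p q : L (p + q) = L p + L q.
Proof. by rewrite /L derivD mulrDr !scalerDr addrACA. Qed.

Let LZ c p : L (c *: p) = c *: L p.
Proof.
by rewrite /L derivZ -scalerAr scalerDr !scalerA; congr (_ *: _ + _ *: _); ring.
Qed.

Let prod_cs : \prod_(c <- map polyC cs) ('X - c) =
  \prod_(k < l) ('X - (x k ^+ 2)%:P) ^+ a.
Proof.
rewrite big_map /cs big_flatten big_map big_enum /=; apply: eq_bigr => k _.
rewrite /shifts big_map; under eq_bigr => i _ do rewrite mulr0 addr0.
by rewrite big_const_seq count_predT size_iota -Monoid.iteropE.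
Qed.

Let EjS (j : nat) : E + j%:Z + 1 = E + j.+1%:Z.
Proof. by lia. Qed.

Let Lmonom (j : nat) : L (monom (E + j%:Z)) = 'X^j.
Proof.
have M0 : 2 * (E + j%:Z)%:~R + 1 != 0 :> R by exact: odd_int_neq0.
have Xd : 'X * ('X^j)^`() = j%:R *: 'X^j :> {poly R}.
  rewrite derivXn; case: j {M0} => [|j]; first by rewrite mulr0n mulr0 scale0r.
  by rewrite mulrnAr -exprS scaler_nat.
rewrite /monom LZ (_ : absz _ = j); last by lia.
rewrite /L Xd scalerA -scalerDl scalerA; apply: etrans (scale1r _).
by congr (_ *: _); move: M0; rewrite intrD => M0; field.
Qed.

Let LPhi j : L (Phi j) = 'X^j * \prod_(k < l) ('X - (x k ^+ 2)%:P) ^+ a.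
Proof.
rewrite -prod_cs /Phi.
have -> : L (tprod (fun=> 0) (map polyC cs) monom (E + j%:Z)) =
    tprod (fun=> 0) (map polyC cs) (L \o monom) (E + j%:Z).
  elim: cs j => //= c s IHs j; rewrite /tstep LD EjS IHs sub0r mulNr.
  by rewrite mul_polyC -scaleNr LZ IHs scaleNr -mul_polyC mulNr.
rewrite (@tprod_eigen _ _ E _ _ 'X) /= ?Lmonom ?lerDl // => M EM /=.
have -> : M = E + (absz (M - E))%:Z by lia.
by rewrite EjS Lmonom // Lmonom subr0 exprSr.
Qed.

Let size_Phi j : (size (Phi j) <= j + a * l + 1)%N.
Proof.
have -> : (a * l = size cs)%N.
  rewrite size_flatten /shape -map_comp sumnE big_map big_enum /=.
  under eq_bigr => i _ do rewrite size_map size_iota.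
  by rewrite sum_nat_const card_ord mulnC.
rewrite /Phi; elim: cs j => [|c s IHs] j /=.
  rewrite /monom (leq_trans (size_scale_leq _ _)) // size_polyXn; lia.
rewrite /tstep (leq_trans (size_polyD _ _)) // geq_max; apply/andP; split.
  by rewrite EjS (leq_trans (IHs j.+1)) // addSnnS.
by rewrite sub0r -polyCN mul_polyC (leq_trans (size_scale_leq _ _)) //
  (leq_trans (IHs j)) // leq_add2r leq_add2l.
Qed.

Lemma antidiff_independent (g : 'I_l -> R) :
  (forall i, \sum_(j < l) g j * antidiff 0 a cs (E + j%:Z) (x i) = 0) ->
  forall j, g j = 0.
Proof.
move=> gF.
have psi_pow i (j : nat) :
    psi 0 (E + j%:Z) (x i) = psi 0 E (x i) * (x i ^+ 2) ^+ j.
  elim: j => [|j IHj]; first by rewrite addr0 mulr1.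
  rewrite -EjS.
  rewrite (psiS (regular_h0 (N := absz (E + j%:Z)) (x_neq0 i))); last by lia.
  by rewrite IHj mulr0 expr0n subr0 -mulrA -exprSr.
pose kappa : R := if odd a then 2 else 1.
have FPhi i (j : nat) : antidiff 0 a cs (E + j%:Z) (x i) =
    kappa * psi 0 E (x i) * (Phi j).[x i ^+ 2].
  have -> : (Phi j).[x i ^+ 2] = tprod (fun=> 0) cs
      (fun M => (2 * M%:~R + 1)^-1 * (x i ^+ 2) ^+ absz (M - E)) (E + j%:Z).
    rewrite /Phi -[LHS]/(horner_eval (x i ^+ 2) _) [LHS]tprod_rmorph.
    have -> : map (horner_eval (x i ^+ 2)) (map polyC cs) = cs.
      by rewrite -map_comp map_id_in // => c _; rewrite /= /horner_eval hornerC.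
    have -> : horner_eval (x i ^+ 2) \o (fun=> 0) = (fun=> 0) :> (int -> R).
      by apply: funext => M; rewrite /= /horner_eval horner0.
    congr (tprod _ _ _ _); apply: funext => M.
    by rewrite /= /horner_eval hornerZ hornerXn.
  have := tprod_lin (fun=> 0) cs (kappa * psi 0 E (x i)) 0
    (fun M => (2 * M%:~R + 1)^-1 * (x i ^+ 2) ^+ absz (M - E)) (fun=> 0)
    (E + j%:Z).
  rewrite [X in _ = _ + X]mul0r addr0 => <-; rewrite /antidiff.
  have -> : node (0 : R) = fun=> 0.
    by apply: funext => M; rewrite /node mulr0 expr0n.
  apply: (@eq_tprod _ _ E); last by rewrite lerDl.
  move=> M EM; rewrite /lam /kappa.
  have -> : psi 0 M (x i) = psi 0 E (x i) * (x i ^+ 2) ^+ absz (M - E).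
    by rewrite -psi_pow; congr psi; lia.
  by rewrite expr0n; case: odd => /=; ring.
have Phi_root i : (\sum_(j < l) g j *: Phi j).[x i ^+ 2] = 0.
  have := gF i; under eq_bigr => j _ do rewrite FPhi mulrCA.
  rewrite -mulr_sumr => /eqP; rewrite !mulf_eq0 => /orP[/orP[]|].
  - by rewrite /kappa; case: odd; rewrite ?oner_eq0 ?pnatr_eq0.
  - case: (E) => n /=; rewrite ?invr_eq0 (negPf (hprod_neq0 (leqnn n) _)) //;
    exact: regular_h0.
  - move=> /eqP <-; rewrite horner_sum; apply: eq_bigr => j _.
    by rewrite hornerZ.
set P := \sum_(j < l) _ in Phi_root.
pose gX : {poly R} := \poly_(j < l) (if insub j is Some j' then g j' else 0).
have gXE : gX = \sum_(j < l) g j *: 'X^j.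
  rewrite /gX poly_def; apply: eq_bigr => j _.
  by rewrite insubT //= => jl; congr (g _ *: _); apply: val_inj.
have LP : L P = gX * \prod_(k < l) ('X - (x k ^+ 2)%:P) ^+ a.
  rewrite gXE mulr_suml /P; apply: (big_ind2 (fun p q => L p = q)).
  - by rewrite /L deriv0 mulr0 !scaler0 addr0.
  - by move=> p p' q q' <- <-; rewrite LD.
  - by move=> j _; rewrite LZ LPhi scalerAl.
(* [P] vanishes at [x i ^+ 2], and [L P] does so to order at least [a]. As [x i] is nonzero, [L]
   lowers an order of vanishing by exactly one, so that of [P] is at least a + 1. *)
have dvdP i (k : nat) : (k <= a)%N -> ('X - (x i ^+ 2)%:P) ^+ k.+1 %| P.
  set r := x i ^+ 2; have r0 : r != 0 by rewrite expf_neq0.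
  elim: k => [_|k IHk ka].
    by rewrite expr1 dvdp_XsubCl; apply/rootP; exact: Phi_root.
  have /dvdpP[Q EQ] := IHk (ltnW ka).
  have : ('X - r%:P) ^+ k.+1 %| L P.
    rewrite LP (bigD1 i) //= dvdp_mull // dvdp_mulr //.
    by rewrite dvdp_exp2l.
  move=> /dvdpP[S ES]; set d := 'X - r%:P in EQ ES *.
  have dN0 : d ^+ k != 0 by rewrite expf_neq0 ?polyXsubC_eq0.
  (* Modulo [d] only 2 (k + 1) T Q remains, so [d] divides [Q]. *)
  have {}ES : S * d = (2 * k.+1%:R) *: ('X * Q)
      + (2 *: ('X * Q^`()) + (2 * E%:~R + 1) *: Q) * d.
    apply: (mulIf dN0); rewrite -mulrA -exprS -ES /L EQ derivM deriv_exp /=.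
    rewrite derivXsubC mul1r exprS -mulr_natl -!mul_polyC polyCM polyC_natr.
    ring.
  have Qr : root Q r.
    have /(congr1 (horner_eval r)) := ES.
    rewrite /horner_eval /d.
    rewrite !(hornerM, hornerD, hornerZ, hornerX, hornerN, hornerC).
    rewrite subrr !mulr0 addr0 => /esym/eqP.
    by rewrite !mulf_eq0 !pnatr_eq0 (negPf (x_neq0 i)).
  have /factor_theorem[Q' EQ'] := Qr; rewrite EQ EQ'.
  by rewrite -mulrA -exprS dvdp_mull.
(* The divisor [q ^+ a.+1] has degree l (a + 1), whereas [P] has degree less than l + a l. *)
have P0 : P = 0.
  apply/eqP; apply: contraT => PN0.
  pose q := \prod_(r <- [seq x i ^+ 2 | i <- enum 'I_l]) ('X - r%:P).
  have /dvdp_leq -/(_ PN0) sP : q ^+ a.+1 %| P.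
    rewrite /q -prodrXl; apply: dvdp_prod_XsubC_exp.
      by rewrite map_inj_uniq // enum_uniq.
    by move=> r /mapP[i _ ->]; exact: dvdP.
  have := size_exp q a.+1; rewrite size_prod_XsubC size_map size_enum_ord /= => sE.
  have sPl : (size P <= l + a * l)%N.
    apply: (big_ind (fun p : {poly R} => (size p <= l + a * l)%N)).
    - by rewrite size_poly0.
    - by move=> p p' pl p'l; rewrite (leq_trans (size_polyD _ _)) // geq_max pl.
    - move=> j _; rewrite (leq_trans (size_scale_leq _ _)) //.
      by rewrite (leq_trans (size_Phi j)) //; have := ltn_ord j; lia.
  have qN0 : q ^+ a.+1 != 0.
    by rewrite expf_neq0 // prodf_seq_neq0; apply/allP => r _; rewrite polyXsubC_eq0.
  have : (0 < size (q ^+ a.+1)%R)%N by rewrite size_poly_gt0.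
  have := leq_trans sP sPl; move: sE; move: (size _) => n.
  by case: n => // n /= ->; rewrite mulnS mulnC ltnn.
have gX0 : gX = 0.
  move: LP; rewrite P0 /L deriv0 mulr0 !scaler0 addr0 => /esym/eqP.
  rewrite mulf_eq0 => /orP[/eqP //|/prodf_eq0[k _]].
  by rewrite expf_eq0 polyXsubC_eq0 andbF.
move=> j; have /polyP/(_ j) := gX0; rewrite coef0 coef_poly ltn_ord.
by rewrite insubT //= => jl; rewrite -[RHS]/0 => <-; congr g; apply: val_inj.
Qed.

End Independence.

(** * Derivations of the cone *)

Lemma hprod_rmorph (A B : comNzRingType) (f : {rmorphism A -> B}) (h : A)
    (n : nat) (t : A) : f (hprod h n t) = hprod (f h) n (f t).
Proof.
rewrite /hprod rmorph_prod; apply: eq_bigr => i _.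
by rewrite rmorphD rmorphM rmorphB !rmorph_nat.
Qed.

Lemma shifts_rmorph (A B : comNzRingType) (f : {rmorphism A -> B}) (h : A)
    (a : nat) (y : A) : map f (shifts h a y) = shifts (f h) a (f y).
Proof.
rewrite /shifts -map_comp; apply: eq_map => i /=.
by rewrite rmorphXn rmorphD rmorphM rmorphD rmorphB rmorphM !rmorph_nat rmorph1.
Qed.

Lemma node_rmorph (A B : comNzRingType) (f : {rmorphism A -> B}) (h : A) :
  f \o node h = node (f h).
Proof. by apply: funext => M; rewrite /= /node rmorphXn rmorphM rmorph_int. Qed.

(** * Homogeneity of the coefficients *)

Section Homogeneity.
Variables (R : comNzRingType) (n : nat) (h : {mpoly R[n]}).
Hypothesis h_homog : h \is 1.-homog.

Lemma natr_mul_dhomog (k : {mpoly R[n]}) (c : int) (d : nat) :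
  k \is d.-homog -> c%:~R * k \is d.-homog.
Proof. by move=> kd; rewrite mulrzl rpredMz. Qed.

Lemma hprod_dhomog (k : nat) (t : {mpoly R[n]}) : t \is 1.-homog ->
  hprod h k t \is (2 * k).+1.-homog.
Proof.
move=> t1; rewrite -[(2 * k).+1]card_ord -sum1_card; apply: dhomog_prod_sum => i.
rewrite rpredD // (_ : _ - _ = (k%:Z - i%:Z)%:~R) ?natr_mul_dhomog //.
by rewrite intrB.
Qed.

Lemma node_dhomog (M : int) : node h M \is 2.-homog.
Proof.
rewrite /node expr2; apply: (@dhomogM _ _ _ 1 _ 1); exact: natr_mul_dhomog.
Qed.

Lemma shifts_dhomog (a : nat) (y : {mpoly R[n]}) : y \is 1.-homog ->
  {in shifts h a y, forall c, c \is 2.-homog}.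
Proof.
move=> y1 c /mapP[i _ ->]; rewrite expr2.
suff : y + (2 * i%:R - a%:R + 1) * h \is 1.-homog.
  by move=> yi; apply: (@dhomogM _ _ _ 1 _ 1).
rewrite rpredD // (_ : _ + 1 = (2 * i%:Z - a%:Z + 1)%:~R) ?natr_mul_dhomog //.
by rewrite intrD intrB intrM.
Qed.

Lemma tprod_dhomog (cs : seq {mpoly R[n]}) (w : int -> {mpoly R[n]})
    (E : int) (d : nat) :
  {in cs, forall c, c \is 2.-homog} ->
  (forall j : nat, w (E + j%:Z) \is (d + 2 * j).-homog) ->
  tprod (node h) cs w E \is (d + 2 * size cs).-homog.
Proof.
move=> cs2 w2; suff H (j : nat) :
    tprod (node h) cs w (E + j%:Z) \is (d + 2 * j + 2 * size cs).-homog.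
  by have := H 0; rewrite addr0 addn0.
elim: cs cs2 j => [|c cs IHcs] cs2 j /=; first by rewrite addn0.
have {}IHcs := IHcs (fun b bcs => cs2 b (mem_behead (s := c :: cs) bcs)).
rewrite /tstep rpredD //.
  have -> : E + j%:Z + 1 = E + j.+1%:Z by lia.
  by have := IHcs j.+1; congr (_ \is _.-homog); lia.
have -> : (d + 2 * j + 2 * (size cs).+1 = 2 + (d + 2 * j + 2 * size cs))%N by lia.
by apply: dhomogM; rewrite // rpredB ?node_dhomog // cs2 ?mem_head.
Qed.

End Homogeneity.

Lemma sum_delta (R : nzRingType) (l : nat) (i : 'I_l) (y : 'I_l -> R) :
  \sum_(k < l) (delta_mx ord0 i : 'rV_l) ord0 k * y k = y i.
Proof.
rewrite (bigD1 i) //= mxE !eqxx mul1r big1 ?addr0 // => k /negPf ki.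
by rewrite mxE ki andbF mul0r.
Qed.

Section Cone.
Variables (R : realType) (l : nat).
Implicit Types (v : 'I_(l + 1) -> R) (i j k : 'I_l) (f : 'I_l -> {mpoly R[l + 1]}).

Definition crd v i := v (lshift 1 i).
Definition lst v := v (rshift l ord0).

(** Coefficients of a derivation that kills the coordinate z. *)
Definition extend f (k : 'I_(l + 1)) :=
  match split k with inl i => f i | inr _ => 0 end.

Lemma extendl f i : extend f (lshift 1 i) = f i.
Proof. by rewrite /extend (unsplitK (inl i)). Qed.

Lemma extendr f (i : 'I_1) : extend f (rshift l i) = 0.
Proof. by rewrite /extend (unsplitK (inr i)). Qed.

Lemma meval_linform_cone (u : 'rV[R]_l) (c : R) v :
  (linform (row_mx u c%:M)).@[v] =
  \sum_i u ord0 i * crd v i + c * lst v.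
Proof.
rewrite meval_linform big_split_ord big_ord1 /= row_mxEr mxE eqxx mulr1n.
by congr (_ + _); apply: eq_bigr => i _; rewrite row_mxEl.
Qed.

Lemma meval_extend (u : 'rV[R]_l) (c : R) f v :
  (\sum_k extend f k * (row_mx u c%:M ord0 k)%:MP).@[v] =
  \sum_i u ord0 i * (f i).@[v].
Proof.
rewrite raddf_sum big_split_ord big_ord1 /= extendr mul0r meval0 addr0.
apply: eq_bigr => i _; rewrite extendl row_mxEl.
by rewrite mevalM mevalC mulrC.
Qed.

Lemma row_mx_neq0 (u : 'rV[R]_l) (c : R) k : u ord0 k != 0 ->
  row_mx u c%:M != 0.
Proof.
by apply: contraNneq => /rowP/(_ (lshift 1 k)); rewrite row_mxEl mxE => ->.
Qed.

(** It suffices to test points whose coordinates i and j are regular, as the product of the two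
    [hprod] does not vanish identically on the hyperplane. *)
Lemma pair_divides (N : nat) i j (eps : R) (s : int) f :
  i != j -> eps ^+ 2 = 1 ->
  (forall v, regular (lst v / 2) N (crd v i) -> regular (lst v / 2) N (crd v j) ->
    crd v i + eps * crd v j = s%:~R * lst v ->
    (f i).@[v] + eps * (f j).@[v] = 0) ->
  linform_divides (row_mx (delta_mx ord0 i + eps *: delta_mx ord0 j) (- s%:~R)%:M)
    (\sum_k extend f k *
      (row_mx (delta_mx ord0 i + eps *: delta_mx ord0 j) (- s%:~R)%:M ord0 k)%:MP).
Proof.
move=> ij eps1 fij; set u := delta_mx ord0 i + _.
have dotu (y : 'I_l -> R) : \sum_k u ord0 k * y k = y i + eps * y j.
  rewrite -[in RHS](sum_delta i y) -[in RHS](sum_delta j y) mulr_sumr -big_split.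
  by apply: eq_bigr => k _; rewrite mxE mulrDl mulrA [X in _ + X * _]mxE.
pose hh : {mpoly R[l + 1]} := 2^-1 *: 'X_(rshift l ord0).
pose g k : {mpoly R[l + 1]} := hprod hh N 'X_(lshift 1 k).
have gE k v : (g k).@[v] = hprod (lst v / 2) N (crd v k).
  by rewrite /g hprod_rmorph /= mevalXU /hh mevalZ mevalXU mulrC.
(* The point of the hyperplane with z = 0, x_i = 1 and x_j = -eps: there h = 0, and the two [hprod]
   are powers of nonzero numbers. *)
pose w0 (k : 'I_(l + 1)) : R :=
  match split k with inl k => (k == i)%:R - eps * (k == j)%:R | inr _ => 0 end.
have w0z : lst w0 = 0 by rewrite /lst /w0 (unsplitK (inr ord0)).
have w0x k : crd w0 k = (k == i)%:R - eps * (k == j)%:R.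
  by rewrite /crd /w0 (unsplitK (inl k)).
have w0i : crd w0 i = 1 by rewrite w0x eqxx (negPf ij) mulr0 subr0.
have w0j : crd w0 j = - eps by rewrite w0x eqxx eq_sym (negPf ij) mulr1 sub0r.
have epsN0 : eps != 0.
  by apply: contra_eq_neq eps1 => ->; rewrite expr0n eq_sym oner_eq0.
apply: (@linform_divides_generic _ _ _ _ (g i * g j) w0).
- apply: (@row_mx_neq0 _ _ i).
  have := dotu (fun k => (k == i)%:R); rewrite eqxx eq_sym (negPf ij) mulr0 addr0.
  rewrite (bigD1 i) //= eqxx mulr1 big1 ?addr0 => [->|k /negPf ->].
    exact: oner_neq0.
  by rewrite mulr0.
- by rewrite meval_linform_cone dotu w0z w0i w0j mulr0 addr0 mulrN -expr2 eps1 subrr.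
- rewrite mevalM mulf_neq0 // gE w0z mul0r hprod_h0 expf_neq0 //.
    by rewrite w0i oner_neq0.
  by rewrite w0j oppr_eq0.
move=> v; rewrite meval_linform_cone meval_extend !dotu mevalM mulf_eq0 negb_or.
move=> /eqP; rewrite mulNr subr_eq0 => /eqP vij /andP[gi gj].
by apply: fij => //; apply: hprod_regular; rewrite -gE.
Qed.

Lemma single_divides i (s : int) f :
  (forall v, 2 * crd v i = s%:~R * lst v -> (f i).@[v] = 0) ->
  linform_divides (row_mx (2 *: delta_mx ord0 i) (- s%:~R)%:M)
    (\sum_k extend f k *
      (row_mx (2 *: delta_mx ord0 i) (- s%:~R)%:M ord0 k)%:MP).
Proof.
have dotu (y : 'I_l -> R) :
    \sum_k (2 *: (delta_mx ord0 i : 'rV[R]_l)) ord0 k * y k = 2 * y i.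
  rewrite -[in RHS](sum_delta i y) mulr_sumr; apply: eq_bigr => k _.
  by rewrite mxE mulrA.
move=> fi; apply/linform_dividesP.
  apply: (@row_mx_neq0 _ _ i).
  by rewrite !mxE !eqxx mulr1 pnatr_eq0.
move=> v; rewrite meval_linform_cone meval_extend !dotu mulNr => /eqP.
by rewrite subr_eq0 => /eqP/fi ->; rewrite mulr0.
Qed.

(** The sign [eps] treats x_i + x_j and x_i - x_j together; the hyperplane z = 0 is respected
    because the derivation kills z. *)
Lemma D_cone_extend (p m a N : nat) f :
  (forall i j (eps : R) (s : int) v, i != j -> eps ^+ 2 = 1 -> `|s| <= a%:Z ->
    regular (lst v / 2) N (crd v i) -> regular (lst v / 2) N (crd v j) ->
    crd v i + eps * crd v j = s%:~R * lst v ->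
    (f i).@[v] + eps * (f j).@[v] = 0) ->
  (forall i (s : int) v, (if (i < p)%N then 1 - m%:Z else - m%:Z) <= s <= m%:Z ->
    2 * crd v i = s%:~R * lst v -> (f i).@[v] = 0) ->
  D (cone (C_arrangement R l p m a)) (derivation_of (extend f)).
Proof.
move=> fpair fsingle; split=> [|v]; first exact: derivation_of_derivation.
rewrite derivation_linform; last exact: derivation_of_derivation.
under eq_bigr => k _ do rewrite derivation_ofX.
case=> [->|[h Ch <-]].
  exists 0; rewrite mulr0 big_split_ord big_ord1 /= extendr mul0r addr0.
  by rewrite big1 // => i _; rewrite row_mxEl mxE mulr0.
case: Ch => [[i [j [s [ij sa ->]]]]|[i [j [s [ij sa ->]]]]
    |[i [s [ip sm ->]]]|[i [s [ip sm ->]]]] /=.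
- rewrite -[delta_mx ord0 j]scale1r; apply: (@pair_divides N).
  + by rewrite neq_ltn ij.
  + by rewrite expr1n.
  + by move=> w *; apply: (fpair i j 1 s); rewrite ?expr1n ?neq_ltn ?ij //; lia.
- rewrite -[- delta_mx ord0 j]scaleN1r; apply: (@pair_divides N).
  + by rewrite neq_ltn ij.
  + by rewrite sqrrN expr1n.
  + by move=> w *; apply: (fpair i j (-1) s);
       rewrite ?sqrrN ?expr1n ?neq_ltn ?ij //; lia.
- by apply: single_divides => w; apply: fsingle; rewrite ip.
- by apply: single_divides => w; apply: fsingle; rewrite ltnNge ip.
Qed.

End Cone.

(** * The hyperplanes *)

Section Hyperplanes.
Variables (R : realType) (l p m a : nat).

(** A finite index type, so that hyperplanes can be listed and counted. The ordinal [s] stands for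
    the level s - a or s - m; hence [ord0] is the level -m, absent for the first [p] coordinates. *)
Definition hyperplane : Type :=
  'I_l * 'I_l * bool * 'I_(2 * a).+1 + 'I_l * 'I_(2 * m).+1 + unit.

Definition is_hyperplane (H : hyperplane) : bool :=
  match H with
  | inl (inl (i, j, _, _)) => (i < j)%N
  | inl (inr (i, s)) => ~~ ((i < p)%N && (s == ord0))
  | inr _ => true
  end.

Definition normal (H : hyperplane) : 'rV[R]_(l + 1) :=
  match H with
  | inl (inl (i, j, b, s)) =>
    row_mx (delta_mx ord0 i + (-1) ^+ b *: delta_mx ord0 j)
           (- (s%:Z - a%:Z)%:~R)%:M
  | inl (inr (i, s)) => row_mx (2 *: delta_mx ord0 i) (- (s%:Z - m%:Z)%:~R)%:M
  | inr _ => row_mx 0 1%:M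
  end.

Arguments normal : simpl never.

Lemma normal_pair i j b s k : normal (inl (inl (i, j, b, s))) ord0 (lshift 1 k) =
  (k == i)%:R + (-1) ^+ b * (k == j)%:R.
Proof. by rewrite /normal row_mxEl !mxE. Qed.

Lemma normal_single i s k : normal (inl (inr (i, s))) ord0 (lshift 1 k) =
  2 * (k == i)%:R.
Proof. by rewrite /normal row_mxEl !mxE. Qed.

Lemma normal_cone (H : hyperplane) : is_hyperplane H ->
  cone (C_arrangement R l p m a) (normal H).
Proof.
case: H => [[[[[i j] b] s]|[i s]]|u] /= PH; last by left.
  right; exists (delta_mx ord0 i + (-1) ^+ b *: delta_mx ord0 j,
    (s%:Z - a%:Z)%:~R) => //; case: b.
    apply: Or42; exists i, j, (s%:Z - a%:Z); rewrite expr1 scaleN1r.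
    by split=> //; have := ltn_ord s; lia.
  apply: Or41; exists i, j, (s%:Z - a%:Z); rewrite expr0 scale1r.
  by split=> //; have := ltn_ord s; lia.
right; exists (2 *: delta_mx ord0 i, (s%:Z - m%:Z)%:~R) => //.
have := ltn_ord s; have [ip|pi] := ltnP i p => sm.
  apply: Or43; exists i, (s%:Z - m%:Z); split=> //.
  by move: PH; rewrite ip /= -val_eqE /=; lia.
by apply: Or44; exists i, (s%:Z - m%:Z); split=> //; lia.
Qed.

Lemma normal_neq0 (H : hyperplane) : is_hyperplane H -> normal H != 0.
Proof.
case: H => [[[[[i j] b] s]|[i s]]|u] PH.
- apply: contra_eq_neq (normal_pair i j b s i) => ->.
  rewrite mxE eqxx (_ : i == j = false); last by apply/negbTE; rewrite neq_ltn [(_ < _)%N]PH.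
  by rewrite mulr0 addr0 eq_sym oner_neq0.
- apply: contra_eq_neq (normal_single i s i) => ->.
  by rewrite mxE eqxx mulr1 eq_sym pnatr_eq0.
- apply/eqP => /rowP/(_ (rshift l ord0)).
  by rewrite /normal row_mxEr !mxE eqxx => /eqP; rewrite oner_eq0.
Qed.

Lemma normal_inj (H K : hyperplane) : is_hyperplane H -> is_hyperplane K ->
  proportional (normal H) (normal K) -> H = K.
Proof.
(* Proportionality is symmetric, so six of the nine pairs of kinds suffice. *)
wlog: H K / match H, K with
  | inl (inl _), _ | inl (inr _), inl (inr _) | inr _, inl (inr _) | inr _, inr _ => true
  | _, _ => false end.
  move=> wl PH PK HK; have KH : proportional (normal K) (normal H).
    by move=> i j; rewrite mulrC -HK mulrC.
  case: H K PH PK HK KH => [[h|h]|h] [[k|k]|k] PH PK HK KH; 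
  by [apply: wl | apply/esym; apply: wl].
have normal_last_l x s : normal (inl (inl (x, s))) ord0 (rshift l ord0) =
    - (s%:Z - a%:Z)%:~R.
  by case: x => -[i j] b; rewrite /normal row_mxEr mxE eqxx.
have normal_last_r i s : normal (inl (inr (i, s))) ord0 (rshift l ord0) =
    - (s%:Z - m%:Z)%:~R.
  by rewrite /normal row_mxEr mxE eqxx.
have normal_z k : normal (inr tt) ord0 (lshift 1 k) = 0.
  by rewrite /normal row_mxEl mxE.
have normal_zz : normal (inr tt) ord0 (rshift l ord0) = 1.
  by rewrite /normal row_mxEr mxE eqxx.
have sgN0 (b : bool) : (-1) ^+ b != 0 :> R by rewrite signr_eq0.
case: H K => [[[[[i j] b] s]|[i s]]|[]] [[[[[i' j'] b'] s']|[i' s']]|[]] //= _.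
- move=> ij ij' HK.
  have nij : (i == j) = false by apply/negbTE; rewrite neq_ltn ij.
  have nij' : (i' == j') = false by apply/negbTE; rewrite neq_ltn ij'.
  (* The entry of [normal K] at [i], where [normal H] has entry 1; it is the scalar between the
     two. *)
  pose c : R := (i == i')%:R + (-1) ^+ b' * (i == j')%:R.
  have Kc k : (k == i')%:R + (-1) ^+ b' * (k == j')%:R =
      ((k == i)%:R + (-1) ^+ b * (k == j)%:R) * c.
    have := HK (lshift 1 i) (lshift 1 k).
    by rewrite !normal_pair eqxx nij mulr0 addr0 mul1r.
  (* Otherwise i' = j and i = j', against i < j and i' < j'. *)
  have ii' : i = i'.
    have := Kc i'; rewrite eqxx nij' mulr0 addr0 eq_sym.
    have [//|ii'] := eqVneq i i'; rewrite add0r.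
    have [i'j|_] := eqVneq i' j; last by rewrite mulr0 mul0r => /eqP; rewrite oner_eq0.
    rewrite /c (negPf ii') add0r.
    have [ij''|_] := eqVneq i j'; last by rewrite !mulr0 => /eqP; rewrite oner_eq0.
    by move: ij ij'; rewrite -i'j ij''; lia.
  subst i'; have c1 : c = 1 by rewrite /c eqxx nij' mulr0 addr0.
  have := Kc j; rewrite c1 mulr1 eqxx eq_sym nij add0r mulr1 add0r.
  have [jj'|_] := eqVneq j j'; last first.
    by rewrite mulr0 => /esym/eqP; rewrite (negPf (sgN0 _)).
  subst j'; rewrite mulr1 => /signr_inj bb'; subst b'.
  have := HK (lshift 1 i) (rshift l ord0).
  rewrite !normal_pair !normal_last_l eqxx nij mulr0 addr0 mul1r mulr1.
  move=> /oppr_inj/eqP; rewrite eqr_int => /eqP ss'.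
  by do 2!congr inl; congr (_, _); apply: val_inj; move: ss' => /=; lia.
- move=> ij _ HK; have nij : (i == j) = false by apply/negbTE; rewrite neq_ltn ij.
  have ii' : i = i'.
    have := HK (lshift 1 i) (lshift 1 i').
    rewrite !normal_pair !normal_single !eqxx nij mulr0 addr0 mul1r mulr1.
    by case: eqVneq => // _; rewrite !mulr0 => /eqP; rewrite pnatr_eq0.
  have := HK (lshift 1 i) (lshift 1 j).
  rewrite !normal_pair !normal_single -ii' !eqxx nij eq_sym nij !mulr0 add0r.
  by rewrite !mulr1 => /esym/eqP; rewrite mulf_eq0 (negPf (sgN0 _)) pnatr_eq0.
- move=> ij _ HK; have nij : (i == j) = false by apply/negbTE; rewrite neq_ltn ij.
  have := HK (lshift 1 i) (rshift l ord0).
  rewrite normal_pair normal_z normal_zz eqxx nij !mulr0 addr0 mulr1.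
  by move=> /eqP; rewrite oner_eq0.
- move=> _ _ HK; have := HK (lshift 1 i) (lshift 1 i').
  rewrite !normal_single !eqxx !mulr1; case: eqVneq => [ii' _|_]; last first.
    by rewrite mulr0 mul0r => /eqP; rewrite mulf_eq0 pnatr_eq0.
  subst i'; have := HK (lshift 1 i) (rshift l ord0).
  rewrite !normal_single !normal_last_r eqxx mulr1 [RHS]mulrC.
  move=> /mulfI; rewrite pnatr_eq0 => /(_ isT)/oppr_inj/eqP; rewrite eqr_int.
  move=> /eqP ss'.
  by congr inl; congr inr; congr (_, _); apply: val_inj; move: ss' => /=; lia.
- move=> _ _ HK; have := HK (lshift 1 i') (rshift l ord0).
  rewrite normal_single normal_z normal_zz eqxx mul0r mul1r !mulr1.
  by move=> /esym/eqP; rewrite pnatr_eq0.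
Qed.

Lemma sum_leq_ord : (\sum_(k < l) (p <= k) = l - p)%N.
Proof.
elim: l => [|k IHk]; first by rewrite big_ord0.
by rewrite big_ord_recr /= IHk; case: leqP; lia.
Qed.

Lemma card_hyperplane : (p <= l)%N ->
  #|is_hyperplane| = (l * (l - 1) * (2 * a).+1 + (2 * m * l + (l - p)) + 1)%N.
Proof.
move=> pl; rewrite -sum1_card big_mkcond /= big_sumType /= big_sumType /=.
congr (_ + _ + _)%N.
- transitivity (\sum_(i < l) \sum_(j < l) \sum_(b : bool)
      \sum_(s < (2 * a).+1) (i < j))%N.
    rewrite pair_bigA pair_bigA pair_bigA /=.
    by apply: eq_bigr => -[[[i j] b] s] _; rewrite unfold_in /=; case: ltnP.
  have E : (2 * (\sum_(i < l) \sum_(j < l) (i < j)) = l * (l - 1))%N.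
    have : (\sum_(i < l) \sum_(j < l) ((i < j) + (j < i) + (i == j)) = l * l)%N.
      rewrite (eq_bigr (fun=> l)) => [|i _]; first by rewrite sum_nat_const card_ord.
      rewrite (eq_bigr (fun=> 1%N)) => [|j _]; first by rewrite sum1_card card_ord.
      by rewrite -val_eqE /=; case: ltngtP.
    have -> : (\sum_(i < l) \sum_(j < l) ((i < j) + (j < i) + (i == j)) =
       \sum_(i < l) \sum_(j < l) (i < j) + \sum_(i < l) \sum_(j < l) (j < i) + l)%N.
      under eq_bigr => i _ do rewrite !big_split /=.
      rewrite !big_split /=; congr (_ + _)%N.
      rewrite (eq_bigr (fun=> 1%N)) => [|i _]; first by rewrite sum1_card card_ord.
      by rewrite (bigD1 i) //= eqxx big1 // => j; rewrite eq_sym => /negPf ->.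
    rewrite [X in (_ + X + _)%N]exchange_big /=; case: l => [|k]; nia.
  rewrite -E mulnAC big_distrr /=; apply: eq_bigr => i _.
  rewrite big_distrr /=; apply: eq_bigr => j _.
  rewrite big_bool /= !sum_nat_const card_ord; case: ltnP => _; lia.
- transitivity (\sum_(i < l) \sum_(s < (2 * m).+1)
      ~~ ((i < p) && (s == ord0)))%N.
    rewrite pair_bigA; apply: eq_bigr => -[i s] _.
    by rewrite unfold_in /=; case: andP.
  rewrite -sum_leq_ord.
  have -> : (2 * m * l = \sum_(i < l) 2 * m)%N by rewrite sum_nat_const card_ord mulnC.
  rewrite -big_split; apply: eq_bigr => i _ /=.
  rewrite big_ord_recl /= andbT -leqNgt (eq_bigr (fun=> 1%N)) => [|s _]; last first.
    by rewrite andbF.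
  by rewrite sum1_card card_ord addnC; case: (p <= i)%N.
- by rewrite sum_nat_const card_unit.
Qed.

End Hyperplanes.

(** * The basis *)

Lemma hprod_root (A : comNzRingType) (h : A) (n : nat) (s : int) :
  `|s| <= n%:Z -> hprod h n (s%:~R * h) = 0.
Proof.
move=> sn; have jn : (absz (n%:Z + s)%R < (2 * n).+1)%N by lia.
rewrite /hprod (bigD1 (Ordinal jn)) //= -mulrDl.
have -> : s%:~R + (n%:R - (absz (n%:Z + s)%R)%:R) = (0%:~R : A).
  by rewrite !pmulrn -intrB -intrD; congr (_%:~R); lia.
by rewrite !mul0r.
Qed.

Section Basis.
Variables (R : realType) (l p m a : nat).
Implicit Types (i j k : 'I_l) (v : 'I_(l + 1) -> R) (M E : int) (N : nat).

Definition xvar i : {mpoly R[l + 1]} := 'X_(lshift 1 i).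
Definition hvar : {mpoly R[l + 1]} := 2^-1 *: 'X_(rshift l ord0).

Lemma meval_xvar v i : (xvar i).@[v] = crd v i.
Proof. exact: mevalXU. Qed.

Lemma meval_hvar v : hvar.@[v] = lst v / 2.
Proof. by rewrite mevalZ mevalXU mulrC. Qed.

Lemma xvar_homog i : xvar i \is 1.-homog.
Proof. by rewrite dhomogX; apply/eqP; exact: mdeg1. Qed.

Lemma hvar_homog : hvar \is 1.-homog.
Proof. by apply: rpredZ; rewrite dhomogX; apply/eqP; exact: mdeg1. Qed.

(** The shifts of x_i are left out: they enter through a weight in closed form, which makes the
    coefficients polynomials. *)
Definition other_shifts i : seq {mpoly R[l + 1]} :=
  flatten [seq shifts hvar a (xvar k) | k <- [seq k <- enum 'I_l | k != i]].

Definition all_shifts v : seq R :=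
  flatten [seq shifts (lst v / 2) a (crd v k) | k <- enum 'I_l].

Lemma all_shifts_perm v i : perm_eq (all_shifts v)
  (map (meval v) (other_shifts i) ++ shifts (lst v / 2) a (crd v i)).
Proof.
rewrite /other_shifts map_flatten -map_comp.
rewrite (eq_map (g := fun k => shifts (lst v / 2) a (crd v k))); last first.
  by move=> k; rewrite /= (shifts_rmorph (meval v)) /= meval_xvar meval_hvar.
have /(perm_map (fun k => shifts (lst v / 2) a (crd v k)))/perm_flatten :
    perm_eq (enum 'I_l) ([seq k <- enum 'I_l | k != i] ++ [:: i]).
  rewrite -(filter_pred1_uniq (enum_uniq 'I_l) (mem_enum _ i)) perm_sym.
  by rewrite perm_catC; apply/permPl/(perm_filterC (pred1 i)).
by rewrite map_cat flatten_cat /= cats0.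
Qed.

Lemma size_other_shifts i : size (other_shifts i) = (a * (l - 1))%N.
Proof.
have := perm_size (all_shifts_perm (fun=> 0) i).
rewrite size_cat !size_map size_iota size_flatten /shape -map_comp sumnE big_map.
rewrite (eq_bigr (fun=> a)) => [|k _]; last by rewrite /= size_map size_iota.
rewrite big_enum /= sum_nat_const card_ord => E.
by rewrite mulnBr muln1 mulnC E addnK.
Qed.

Lemma all_shifts_sub v i : {subset shifts (lst v / 2) a (crd v i) <= all_shifts v}.
Proof.
by move=> c ci; rewrite (perm_mem (all_shifts_perm v i)) mem_cat ci orbT.
Qed.

(** [tprod_shifts_lam] accounts for the shifts of x_i, so at regular points the polynomial is a
    multiple of F(x_i). *)
Lemma meval_tprod N i (w : int -> {mpoly R[l + 1]}) E v (c : R) :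
  regular (lst v / 2) N (crd v i) -> 1 - N%:Z <= E ->
  (forall M, E <= M -> (w M).@[v] =
    c * (beta R a M * psi (lst v / 2) (M + a%:Z) (crd v i))) ->
  (tprod (node hvar) (other_shifts i) w E).@[v] =
  c * antidiff (lst v / 2) a (all_shifts v) E (crd v i).
Proof.
move=> iN NE wE; rewrite (tprod_rmorph (meval v)) node_rmorph /= meval_hvar.
rewrite /antidiff (tprod_perm _ _ (all_shifts_perm v i)) tprod_cat.
set cs := map _ _; set h := lst v / 2.
have := tprod_lin (node h) cs c 0
  (tprod (node h) (shifts h a (crd v i)) (fun M => lam h a M (crd v i))) (fun=> 0) E.
rewrite [X in _ = _ + X]mul0r addr0 => <-.
apply: (@eq_tprod _ _ E) => // M EM /=.
by rewrite wE // (tprod_shifts_lam _ iN) ?mulr0 ?addr0 //; lia.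
Qed.

(** F is odd: for eps = 1 the point x_i is compared with -x_j, for eps = -1 with x_j, at distance s
    z = 2 s h. *)
Lemma antidiff_pair N i j (eps : R) (s : int) E v : eps ^+ 2 = 1 ->
  `|s| <= a%:Z -> (2 * a < N)%N -> 2 + 2 * a%:Z - N%:Z <= E ->
  regular (lst v / 2) N (crd v i) -> regular (lst v / 2) N (crd v j) ->
  crd v i + eps * crd v j = s%:~R * lst v ->
  antidiff (lst v / 2) a (all_shifts v) E (crd v i) +
  eps * antidiff (lst v / 2) a (all_shifts v) E (crd v j) = 0.
Proof.
move=> eps1 sa aN NE iN jN vij; set h := lst v / 2.
have Ei (u : R) : u = - eps * crd v j -> crd v i = u + 2 * s%:~R * h.
  move=> ->; have -> : 2 * s%:~R * h = s%:~R * lst v.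
    by rewrite /h mulrC mulrA mulfVK ?pnatr_eq0 // mulrC.
  by rewrite -vij; ring.
have /orP[/eqP e|/eqP e] : (eps == 1) || (eps == -1) by rewrite -sqrf_eq1 eps1.
  rewrite (@antidiff_eq _ _ N a s _ E (- crd v j)) //.
  - by rewrite antidiffN e mul1r addNr.
  - exact: regularN.
  - by apply: Ei; rewrite e mulN1r.
  - by move=> c; rewrite shiftsN; exact: all_shifts_sub.
  - exact: all_shifts_sub.
rewrite (@antidiff_eq _ _ N a s _ E (crd v j)) //.
- by rewrite e mulN1r subrr.
- by apply: Ei; rewrite e opprK mul1r.
- exact: all_shifts_sub.
- exact: all_shifts_sub.
Qed.

(** * The derivations [theta j] *)

Definition theta_weight i M : {mpoly R[l + 1]} :=
  (beta R a M)%:MP * hprod hvar (absz (M + a%:Z)) (xvar i).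

(** The polynomial form of F_E(x_i) for E = m - a + j. All indices M >= E satisfy M + a >= 0, so the
    [absz] in the weight changes nothing. *)
Definition theta (j : nat) i : {mpoly R[l + 1]} :=
  tprod (node hvar) (other_shifts i) (theta_weight i) (m%:Z - a%:Z + j%:Z).

Lemma meval_theta N (j : nat) i v :
  regular (lst v / 2) N (crd v i) -> (a < N)%N ->
  (theta j i).@[v] = antidiff (lst v / 2) a (all_shifts v)
    (m%:Z - a%:Z + j%:Z) (crd v i).
Proof.
move=> iN aN; rewrite -[RHS]mul1r; apply: (meval_tprod iN); first by lia.
move=> M EM; rewrite mul1r /theta_weight mevalM mevalC.
rewrite (hprod_rmorph (meval v)) /= meval_hvar meval_xvar; congr (_ * _).
by have -> : M + a%:Z = absz (M + a%:Z) by lia.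
Qed.

Lemma D_theta (j : nat) :
  D (cone (C_arrangement R l p m a)) (derivation_of (extend (theta j))).
Proof.
(* The radius N = 3a + 3 turns the bound 2 + 2a - N on the index into -a - 1, which [phi] attains
   for m = 0. *)
apply: (@D_cone_extend _ _ _ _ _ (3 * a + 3)) => [i k eps s v ik eps1 sa iN kN vik|].
  rewrite !(meval_theta (N := 3 * a + 3)) //; try lia.
  by apply: (antidiff_pair (N := 3 * a + 3) (s := s)) => //; lia.
move=> i s v sm vi; rewrite /theta (tprod_rmorph (meval v)).
(* Every weight vanishes on 2 x_i = s z, because M + a >= m >= |s|. *)
apply: (@tprod_eq0 _ _ (m%:Z - a%:Z)); last by lia.
move=> M EM /=; rewrite /theta_weight mevalM (hprod_rmorph (meval v)) /=.
rewrite meval_hvar meval_xvar (_ : crd v i = s%:~R * (lst v / 2)).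
  by rewrite hprod_root ?mulr0 //; case: ifP sm => _; lia.
by rewrite mulrA -vi mulrC mulKf ?pnatr_eq0.
Qed.

Lemma theta_homog (j : nat) i :
  theta j i \is (2 * (m + j) + 1 + 2 * (a * (l - 1))).-homog.
Proof.
rewrite -(size_other_shifts i); apply: tprod_dhomog.
- exact: hvar_homog.
- move=> c /flattenP[s /mapP[k _ ->]].
  by apply: shifts_dhomog; [exact: hvar_homog | exact: xvar_homog].
move=> k; rewrite /theta_weight mul_mpolyC; apply: rpredZ.
have := hprod_dhomog hvar_homog (absz (m%:Z - a%:Z + j%:Z + k%:Z + a%:Z)) (xvar_homog i).
by congr (_ \is _.-homog); lia.
Qed.

(** * The derivation [phi] *)

Definition phi_scale i : {mpoly R[l + 1]} :=
  \prod_(k | k != i) (xvar k - m%:R * hvar)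
  * \prod_(k : 'I_l | (p <= k)%N) (xvar k + m%:R * hvar).

(* The value 1 is that of (x - m h) * psi h (-1) x for m = 0. *)
Definition phi_weight i M : {mpoly R[l + 1]} :=
  (beta R a M)%:MP * (if 0 <= M + a%:Z
    then (xvar i - m%:R * hvar) * hprod hvar (absz (M + a%:Z)) (xvar i) else 1).

(** F_E for E = m - a - 1, times [phi_factor]. As E + a = m - 1, the multiplier has to supply s = m
    for all coordinates and s = -m for those from [p] on. Its factor x_i - m h sits in the weight,
    where it cancels the pole at m = 0. *)
Definition phi i : {mpoly R[l + 1]} :=
  phi_scale i * tprod (node hvar) (other_shifts i) (phi_weight i)
    (m%:Z - a%:Z - 1).

(** The full multiplier; being the same for all [i], it preserves the relations between the
    coefficients. *)
Definition phi_factor v : R :=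
  \prod_k (crd v k - m%:R * (lst v / 2))
  * \prod_(k : 'I_l | (p <= k)%N) (crd v k + m%:R * (lst v / 2)).

Lemma meval_phi_scale i v : phi_factor v =
  (crd v i - m%:R * (lst v / 2)) * (phi_scale i).@[v].
Proof.
rewrite /phi_factor (bigD1 i) //= -mulrA /phi_scale mevalM !rmorph_prod.
congr (_ * (_ * _)); apply: eq_bigr => k _ /=.
  by rewrite mevalB mevalM meval_xvar meval_hvar rmorph_nat.
by rewrite mevalD mevalM meval_xvar meval_hvar rmorph_nat.
Qed.

Lemma meval_phi_weight i M v : 0 <= M + a%:Z -> (phi_weight i M).@[v] =
  beta R a M * ((crd v i - m%:R * (lst v / 2))
    * hprod (lst v / 2) (absz (M + a%:Z)) (crd v i)).
Proof.
move=> Ma; rewrite /phi_weight Ma mevalM mevalC mevalM mevalB mevalM.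
by rewrite (hprod_rmorph (meval v)) /= meval_hvar meval_xvar rmorph_nat.
Qed.

Lemma meval_phi N i v : regular (lst v / 2) N (crd v i) -> (a + 1 < N)%N ->
  (phi i).@[v] = phi_factor v * antidiff (lst v / 2) a (all_shifts v)
    (m%:Z - a%:Z - 1) (crd v i).
Proof.
move=> iN aN; rewrite /phi mevalM (meval_phi_scale i) -[RHS]mulrA [RHS]mulrCA; congr (_ * _).
apply: (meval_tprod iN); first by lia.
move=> M EM; have [Ma|Ma] := leP 0 (M + a%:Z).
  rewrite meval_phi_weight // mulrCA; congr (_ * (_ * _)).
  by have -> : M + a%:Z = absz (M + a%:Z) by lia.
have m0 : m = 0%N by lia.
have -> : M + a%:Z = Negz 0 by lia.
rewrite /phi_weight leNgt Ma /= mevalM mevalC meval1 mulr1 m0 mul0r subr0 hprod0.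
by rewrite mulrCA mulfV ?mulr1 //; exact: regular_neq0 iN.
Qed.

Lemma D_phi : D (cone (C_arrangement R l p m a)) (derivation_of (extend phi)).
Proof.
apply: (@D_cone_extend _ _ _ _ _ (3 * a + 3)) => [i k eps s v ik eps1 sa iN kN vik|].
  rewrite !(meval_phi (N := 3 * a + 3)) //; try lia.
  rewrite mulrCA -mulrDr (antidiff_pair (N := 3 * a + 3) (s := s)) ?mulr0 //; lia.
move=> i s v sm vi.
have Ei : crd v i = s%:~R * (lst v / 2).
  by rewrite mulrA -vi mulrC mulKf ?pnatr_eq0.
rewrite /phi mevalM; have [sE|sN] := eqVneq s (- m%:Z).
  have pi : (p <= i)%N by case: ltnP sm => // _; lia.
  rewrite /phi_scale mevalM [X in _ * X * _](_ : _ = 0) ?mulr0 ?mul0r //.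
  rewrite (bigD1 i) //= mevalM mevalD mevalM meval_xvar meval_hvar rmorph_nat.
  by rewrite Ei sE mulrNz mulNr addNr mul0r.
rewrite (tprod_rmorph (meval v)) (@tprod_eq0 _ _ (m%:Z - a%:Z - 1)) ?mulr0 //.
(* This forces m >= 1, so the polynomial branch of the weight applies: s = m kills x_i - m h, and
   |s| < m kills [hprod]. *)
have {}sm : 1 - m%:Z <= s <= m%:Z by case: ifP sm => _; lia.
move=> M EM /=; rewrite meval_phi_weight; last by lia.
rewrite Ei; have [->|sm'] := eqVneq s m%:Z.
  by rewrite -pmulrn subrr mul0r mulr0.
by rewrite hprod_root ?mulr0 //; lia.
Qed.

Lemma phi_homog i : (p <= l)%N ->
  phi i \is (l - 1 + (l - p) + (2 * m + 2 * (a * (l - 1)))).-homog.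
Proof.
move=> pl; have mh : m%:R * hvar \is 1.-homog.
  exact: (natr_mul_dhomog m%:Z hvar_homog).
have h1 k : xvar k - m%:R * hvar \is 1.-homog by rewrite rpredB ?xvar_homog.
have h2 k : xvar k + m%:R * hvar \is 1.-homog by rewrite rpredD ?xvar_homog.
apply: dhomogM; [apply: dhomogM|].
- have -> : (l - 1 = \sum_k (k != i))%N.
    have E : (\sum_k (k != i) + 1 = l)%N; last by move: E; lia.
    rewrite -[RHS]card_ord -sum1_card [RHS](bigD1 i) //= addnC (bigD1 i) //=.
    rewrite eqxx add0n; congr (_ + _)%N.
    by apply: eq_bigr => k ->.
  rewrite big_mkcond; apply: dhomog_prod_sum => k.
  by case: eqVneq => _ //=; exact: dhomog1.
- rewrite -(sum_leq_ord l p) big_mkcond; apply: dhomog_prod_sum => k.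
  by case: leqP => _ //=; exact: dhomog1.
rewrite -(size_other_shifts i); apply: tprod_dhomog.
- exact: hvar_homog.
- move=> c /flattenP[s /mapP[k _ ->]].
  by apply: shifts_dhomog; [exact: hvar_homog | exact: xvar_homog].
move=> k; rewrite /phi_weight mul_mpolyC; apply: rpredZ; case: leP => Mk.
  have := dhomogM (h1 i) (hprod_dhomog hvar_homog
    (absz (m%:Z - a%:Z - 1 + k%:Z + a%:Z)) (xvar_homog i)).
  by congr (_ \is _.-homog); lia.
(* The branch with value 1 occurs only for m = k = 0. *)
by rewrite (_ : (2 * m + 2 * k = 0)%N) ?dhomog1 //; lia.
Qed.

(** * The basis and its determinant *)

Definition basis_coef (n : nat) : 'I_(l + 1) -> {mpoly R[l + 1]} :=
  match n with
  | 0 => fun q : 'I_(l + 1) => 'X_q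
  | 1 => extend phi
  | j.+2 => extend (theta j)
  end.

Lemma D_basis_coef (n : nat) :
  D (cone (C_arrangement R l p m a)) (derivation_of (basis_coef n)).
Proof.
case: n => [|[|j]] /=; [|exact: D_phi | exact: D_theta].
split=> [|v _]; first exact: derivation_of_derivation.
exists 1; rewrite derivation_linform; last exact: derivation_of_derivation.
rewrite mulr1; apply: eq_bigr => k _.
by rewrite derivation_ofX mulrC mul_mpolyC.
Qed.

Lemma mpolyXU_neq0 (k : 'I_(l + 1)) : 'X_k != 0 :> {mpoly R[l + 1]}.
Proof.
apply/eqP => /(congr1 (meval (fun=> 1))); rewrite mevalXU meval0 => /eqP.
by rewrite oner_eq0.
Qed.

(** A point with z = 0 whose other coordinates are nonzero with distinct squares, as
    [antidiff_independent] requires. *)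
Let v0 (k : 'I_(l + 1)) : R :=
  match split k with inl i => i.+1%:R | inr _ => 0 end.

Let lst_v0 : lst v0 / 2 = 0.
Proof. by rewrite /lst /v0 (unsplitK (inr ord0)) mul0r. Qed.

Let crd_v0 i : crd v0 i = i.+1%:R.
Proof. by rewrite /crd /v0 (unsplitK (inl i)). Qed.

Let crd_v0_neq0 i : crd v0 i != 0.
Proof. by rewrite crd_v0 pnatr_eq0. Qed.

(** Only the Euler derivation has a nonzero coefficient at z. Once z is divided out of that column,
    the matrix is evaluated at z = 0, where a relation between its rows contradicts the independence
    of F_E for the l consecutive values of E from m - a - 1 on. *)
Lemma det_basis_coef : (0 < l)%N ->
  \det (\matrix_(i < l + 1, k < l + 1) basis_coef i k) != 0.
Proof.
move=> l_gt0.
pose N1 := \matrix_(i < l + 1, k < l + 1) match split k with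
  | inl _ => basis_coef i k | inr _ => (i == 0 :> nat)%:R end.
pose d : 'rV[{mpoly R[l + 1]}]_(l + 1) :=
  \row_k match split k with inl _ => 1 | inr _ => 'X_k end.
have -> : \matrix_(i < l + 1, k < l + 1) basis_coef i k = N1 *m diag_mx d.
  rewrite mul_mx_diag; apply/matrixP => i k; rewrite !mxE.
  case: splitP => [k' Ek|k' Ek]; first by rewrite mulr1.
  have -> : k = rshift l k' by apply: val_inj.
  by case: (nat_of_ord i) => [|[|j]] /=; rewrite ?mul1r ?extendr ?mul0r.
rewrite det_mulmx det_diag mulf_neq0 //; last first.
  apply/prodf_neq0 => k _; rewrite mxE; case: split => _.
    exact: oner_neq0.
  exact: mpolyXU_neq0.
apply/eqP => /(congr1 (meval v0)); rewrite meval0 -det_map_mx => /eqP/det0P[u].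
move=> u0 uN; apply/negP: u0; rewrite negbK.
pose U (n : nat) : R := if insub n is Some i then u ord0 i else 0.
have UE (i : 'I_(l + 1)) : u ord0 i = U i by rewrite /U valK.
have sum_recl (F : nat -> R) :
    \sum_(i < l + 1) F i = F 0%N + \sum_(i < l) F i.+1.
  by rewrite -(big_mkord xpredT F) big_ltn ?addn1 // big_add1 /= big_mkord.
have U0 : U 0%N = 0.
  move/rowP/(_ (rshift l ord0)): uN; rewrite !mxE.
  under eq_bigr => i _ do rewrite !mxE (unsplitK (inr ord0)) rmorph_nat UE.
  rewrite (sum_recl (fun n => U n * (n == 0)%:R)) /= mulr1 big1 ?addr0 //.
  by move=> i _; rewrite mulr0.
have Pi0 : phi_factor v0 != 0.
  rewrite /phi_factor lst_v0 mulr0 mulf_neq0 //; apply/prodf_neq0 => k _.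
    by rewrite subr0.
  by rewrite addr0.
(* The row of [phi] carries the additional nonzero factor [phi_factor v0]. *)
pose g (j : 'I_l) : R := U j.+1 * (if j == 0 :> nat then phi_factor v0 else 1).
have reg i : regular (lst v0 / 2) (a + 2) (crd v0 i).
  by rewrite lst_v0; apply: regular_h0.
have g0 : forall j, g j = 0.
  apply: (@antidiff_independent _ _ a (crd v0) (m%:Z - a%:Z - 1)) => [//|i j|i].
    rewrite !crd_v0 => /eqP; rewrite eqrXn2 ?ler0n // eqr_nat eqSS.
    by move=> /eqP/val_inj.
  move/rowP/(_ (lshift 1 i)): uN; rewrite !mxE => uNi; rewrite -[RHS]uNi.
  under [RHS]eq_bigr => n _ do rewrite !mxE (unsplitK (inl i)) UE.
  rewrite (sum_recl (fun n => U n * (basis_coef n (lshift 1 i)).@[v0])).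
  rewrite U0 mul0r add0r; apply: eq_bigr => j _; rewrite /g -mulrA; congr (_ * _).
  have := reg i; case: (nat_of_ord j) => [|j'] regi /=; rewrite extendl.
    rewrite (meval_phi regi) ?lst_v0 ?addr0 //; last by lia.
    by rewrite /all_shifts lst_v0.
  rewrite (meval_theta _ regi) ?lst_v0 ?mul1r //; last by lia.
  by rewrite /all_shifts lst_v0; congr antidiff; lia.
apply/eqP/rowP => i; rewrite mxE UE.
case: i => -[|n] /= nl; first exact: U0.
have nl' : (n < l)%N by rewrite addn1 in nl.
have /eqP := g0 (Ordinal nl'); rewrite /g mulf_eq0 /= => /orP[/eqP //|].
by case: ifP => _; rewrite ?(negPf Pi0) ?oner_eq0.
Qed.

End Basis.

(** * Exponents and conclusion *)

Lemma sumn_odd_shift (c n : nat) :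
  sumn [seq (c + (2 * k + 1))%N | k <- iota 0 n] = (n * c + n * n)%N.
Proof.
elim: n => [|n IHn]; first by [].
by rewrite -(addn1 n) iotaD map_cat sumn_cat IHn /= addn0; nia.
Qed.

Theorem theorem5p11 (R : realType) (a m l p : nat)
    (l_gt0 : (0 < l)%N) (p_le_l : (p <= l)%N) :
  let c := (2 * m + 2 * a * l - 2 * a)%N in
  let e := [:: 1%N, (c + 2 * l - p - 1)%N
             & [seq (c + (2 * k + 1))%N | k <- iota 0 (l - 1)]] in
  free_arrangement (cone (C_arrangement R l p m a)) /\
  has_exponents (cone (C_arrangement R l p m a)) e.
Proof.
move=> c e; suff He : has_exponents (cone (C_arrangement R l p m a)) e.
  by split=> //; have [b [Hb _]] := He; exists (size e), b.
have size_e : size e = (l + 1)%N by rewrite /= size_map size_iota; lia.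
have cE : c = (2 * m + 2 * (a * (l - 1)))%N.
  by rewrite /c mulnBr muln1 -mulnA; have := leq_pmulr a l_gt0; lia.
have e_homog (n : nat) k : (n < l + 1)%N ->
    @basis_coef R l p m a n k \is (nth 0%N e n).-homog.
  case: n => [|[|j]] nl /=.
  - by rewrite dhomogX; apply/eqP; exact: mdeg1.
  - rewrite /extend; case: split => [i|_]; last exact: rpred0.
    by have := @phi_homog R l p m a i p_le_l; congr (_ \is _.-homog); lia.
  - rewrite /extend; case: split => [i|_]; last exact: rpred0.
    rewrite (nth_map 0%N) ?size_iota; last by lia.
    rewrite nth_iota; last by lia.
    by have := @theta_homog R l m a j i; congr (_ \is _.-homog); lia.
exists (fun i => derivation_of (@basis_coef R l p m a i)); split; last first.
  move=> i k; rewrite derivation_ofX; apply: e_homog.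
  by rewrite -size_e.
pose s := enum (@is_hyperplane l p m a).
(* [size e] equals l + 1 only propositionally; abstracting it as [n] allows the replacement in the
   index type. *)
suff H n : n = (l + 1)%N -> D_basis (cone (C_arrangement R l p m a))
    (fun i : 'I_n => derivation_of (@basis_coef R l p m a i)) by exact: H size_e.
move=> ->.
apply: (@saito_criterion _ _ _ _ s (@normal R l m a) _ (fun i => nth 0%N e i)).
- exact: enum_uniq.
- by move=> h; rewrite mem_enum => /normal_neq0; apply.
- move=> h k; rewrite !mem_enum => hP kP; exact: normal_inj hP kP.
- by move=> h; rewrite mem_enum; exact: normal_cone.
- by move=> i; exact: D_basis_coef.
- by move=> i k; exact: e_homog.
(* The sum of the exponents and the number of hyperplanes are both 2ml + 2al(l - 1) + l^2 - p +
   1. *)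
- have -> : (\sum_(i < l + 1) nth 0 e i = sumn e)%N.
    by rewrite sumnE (big_nth 0%N) big_mkord size_e.
  rewrite /s -cardE card_hyperplane //= sumn_odd_shift cE.
  case: l l_gt0 p_le_l {s size_e e_homog e cE c} => // k _ pk.
  by rewrite subn1 /=; nia.
- exact: det_basis_coef.
Qed.
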